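(* Let $d\ge4$. No $d$-dimensional polytope with $d+4$ vertices has exactly $\phi(d+4,d)+1$ edges. Equivalently, if $P$ is a $d$-polytope with $d+4$ vertices, then either $P$ is the triplex $M_{4,d-4}$, or its excess degree $2f_1(P)-d f_0(P)$ is at least $3d-8$.
   Context: $\phi(v,d)=\binom{d+1}{2}+\binom{d}{2}-\binom{2d+1-v}{2}$. The triplex $M_{4,d-4}$ is any polytope combinatorially equivalent to a $(d-4)$-fold pyramid over a 4-dimensional simplicial prism (combinatorially the product of a tetrahedron and a segment). *)

(* Defs.v *)
From mathcomp Require Import all_boot all_order all_algebra.
From mathcomp Require Import finmap.
From mathcomp Require Import boolp classical_sets functions cardinality reals.
From mathcomp Require Import convex.

Set Implicit Arguments.
Unset Strict Implicit.
Unset Printing Implicit Defensive.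

Import Order.TTheory GRing.Theory Num.Theory.
Local Open Scope classical_set_scope.
Local Open Scope ring_scope.

Section Polytopes.
Context {R : realType}.

Definition convex_hull n (A : set 'rV[R]_n) : set 'rV[R]_n :=
  smallest (@convex_set R 'rV[R]_n) A.

Definition affine_hull n (A : set 'rV[R]_n) : set 'rV[R]_n :=
  [set x | exists k (p : 'I_k -> 'rV[R]_n) (w : 'I_k -> R),
     [/\ forall i, A (p i), \sum_i w i = 1 & x = \sum_i w i *: p i]].

(* The empty set has no dimension in this sense, so the conventional value -1
   never arises. *)
Definition has_dim n (A : set 'rV[R]_n) (d : nat) : Prop :=
  exists (x : 'rV[R]_n) (U : {vspace 'rV[R]_n}),
    \dim U = d /\ affine_hull A = [set x + u | u in [set` U]].

Definition polytope n (P : set 'rV[R]_n) : Prop :=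
  exists2 V : set 'rV[R]_n, finite_set V & P = convex_hull V.

(* The linear form c may be zero, so that P itself (0 <= 0) and the empty set
   (0 <= 1) are faces. *)
Definition faces n (P : set 'rV[R]_n) : set (set 'rV[R]_n) :=
  [set F | exists (c : {scalar 'rV[R]_n}) (b : R),
     (forall x, P x -> c x <= b) /\ F = [set x | P x /\ c x = b]].

(* [fset_set] is empty on infinite sets; a polytope has finitely many faces. *)
Definition fnum n (P : set 'rV[R]_n) (i : nat) : nat :=
  #|` fset_set [set F | faces P F /\ has_dim F i]|%fset.

(* The number d is meant to be the dimension of P. *)
Definition excess_degree n (P : set 'rV[R]_n) (d : nat) : int :=
  2 * (fnum P 1)%:Z - d%:Z * (fnum P 0)%:Z.

Definition combinatorially_equivalent n m
    (P : set 'rV[R]_n) (Q : set 'rV[R]_m) : Prop :=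
  exists f : set 'rV[R]_n -> set 'rV[R]_m,
    set_bij (faces P) (faces Q) f /\
    (forall F G, faces P F -> faces P G -> (f F `<=` f G <-> F `<=` G)).

Definition affinely_independent n k (p : 'I_k -> 'rV[R]_n) : Prop :=
  forall w : 'I_k -> R,
    \sum_i w i = 0 -> \sum_i w i *: p i = 0 -> forall i, w i = 0.

Definition simplex n (k : nat) (S : set 'rV[R]_n) : Prop :=
  exists2 p : 'I_k.+1 -> 'rV[R]_n,
    affinely_independent p & S = convex_hull (range p).

Definition cartesian_product n m (S : set 'rV[R]_n) (T : set 'rV[R]_m) :
    set 'rV[R]_(n + m) :=
  [set row_mx x y | x in S & y in T].

(* A simplicial k-prism has dimension k, hence its base has dimension k - 1;
   only k >= 1 is meaningful. *)
Definition simplicial_prism n (k : nat) (B : set 'rV[R]_n) : Prop :=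
  polytope B /\
  exists (a b : nat) (S : set 'rV[R]_a) (T : set 'rV[R]_b),
    [/\ simplex k.-1 S, simplex 1 T &
        combinatorially_equivalent B (cartesian_product S T)].

Fixpoint iterated_pyramid n (l : nat) (B P : set 'rV[R]_n) : Prop :=
  if l is l'.+1 then
    exists (Q : set 'rV[R]_n) (x : 'rV[R]_n),
      [/\ iterated_pyramid l' B Q, ~ affine_hull Q x &
          P = convex_hull (Q `|` [set x])]
  else P = B.

(* The triplex M_{k,l}.  The pyramid may live in a space R^m other than that of
   P, in which there is always room for the l apexes. *)
Definition triplex n (k l : nat) (P : set 'rV[R]_n) : Prop :=
  exists m (B Q : set 'rV[R]_m),
    [/\ simplicial_prism k B, iterated_pyramid l B Q &
        combinatorially_equivalent P Q].

End Polytopes.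

(* The subtractions are not truncated in the range d < v <= 2 d. *)
Definition phi (v d : nat) : nat :=
  ('C(d.+1, 2) + 'C(d, 2) - 'C((2 * d).+1 - v, 2))%N.

(* Main.v *)
(** Gale duality.  Let [P] be a [d]-polytope with vertices [p_i], [i < d + 4].
    The affine dependencies of the vertices form a space [D] of dimension 3, and
    every nonzero element of [D] has at least two negative coordinates.  A pair
    of vertices fails to span an edge exactly when it is the set of negative
    coordinates of an element of [D]; such a pair is called a coedge.  So we
    must show that there are at most 10 coedges, unless [P] is the triplex.

    View [D] as a family of vectors [g_i] in R^3, the coordinate forms.  If
    [g_u] is a positive combination of independent vectors [g_t], [t \in T],
    with [u \notin T], then every coedge at [u] meets [T]; so there are at most
    three coedges at [u].

    If there are three, then, after scaling, [g_u = g_1 + g_2 + g_3] for a basis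
    [g_1, g_2, g_3], and all other vectors lie in the opposite of the cone of
    this basis.  A coedge that avoids 1, 2 and 3 is then one of the sets
    [S_i = {w | g_w has a nonzero i-th coordinate}]; this gives the bound
    [3 * 3 + 3 = 12], and a case analysis shows that 11 or more coedges force
    the vectors to be those of the prism over a tetrahedron, up to zeros (the
    apexes of the pyramids) and positive factors.

    If no vertex lies in three coedges, we look for a set of vectors that
    positively spans R^3, because every coedge meets it.  Either there is one
    with five elements, or every nonzero vector has a positive multiple among
    the other vectors; in the latter case each vertex lies in at most one
    coedge, and a positively spanning set with six elements suffices. *)

Require Import Defs.
From HB Require Import structures.
From mathcomp Require Import all_boot all_order all_algebra.
From mathcomp Require Import boolp.
From mathcomp Require Import zify ring lra.

Set Implicit Arguments.
Unset Strict Implicit.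
Unset Printing Implicit Defensive.

Import Order.TTheory GRing.Theory Num.Theory.
Local Open Scope ring_scope.

(** * Farkas and Caratheodory *)

Section Farkas.
Context {R : realFieldType}.

(* Bartl's induction on the set of constraints: at the step, the other
   constraints are restricted to the kernel of the new one by projecting along
   a vector [x0] that violates the conclusion. *)
Lemma farkas k n (A : 'M[R]_(k, n)) (T : {set 'I_n}) (b : 'cV[R]_k) :
    (forall x : 'rV_k, (forall i, i \in T -> 0 <= (x *m A) 0 i) ->
       0 <= (x *m b) 0 0) ->
  exists a : 'cV[R]_n,
    [/\ forall i, 0 <= a i 0, forall i, i \notin T -> a i 0 = 0 & A *m a = b].
Proof.
move: {2}_.+1 (ltnSn #|T|) => N; elim: N A T b => // N IHN A T b TN H.
have [T0|[j jT]] := set_0Vmem T.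
  exists 0; split=> [i|i _|]; rewrite ?mxE // mulmx0.
  have Hb (x : 'rV_k) : 0 <= (x *m b) 0 0 by apply: H => i; rewrite T0 inE.
  apply/colP => i; rewrite mxE.
  have := Hb (delta_mx 0 i); have := Hb (- delta_mx 0 i).
  by rewrite mulNmx -rowE !mxE; lra.
have TjN : (#|T :\ j| < N)%N by move: TN; rewrite (cardsD1 j T) jT.
have [H1|/existsNP[x0 /not_implyP[x0T /negP]]] := pselect
    (forall x : 'rV_k, (forall i, i \in T :\ j -> 0 <= (x *m A) 0 i) ->
       0 <= (x *m b) 0 0).
  have [a [a0 aT ab]] := IHN _ _ _ TjN H1; exists a; split=> // i iT.
  by apply: aT; rewrite in_setD1 negb_and iT orbT.
rewrite -ltNge => x0b.
have x0j : (x0 *m A) 0 j < 0.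
  rewrite ltNge; apply/negP => x0j; move: x0b; rewrite ltNge H // => i iT.
  have [->//|ij] := eqVneq i j.
  by apply: x0T; rewrite in_setD1 ij.
(* [z] is [x0] scaled so that its value on constraint [j] is -1; then [x + (x *m c) z] is the
   projection of [x] onto the kernel of constraint [j]. *)
pose s := (- (x0 *m A) 0 j)^-1; pose z := s *: x0.
have s0 : 0 < s by rewrite invr_gt0 oppr_gt0.
have zj : (z *m A) 0 j = -1.
  by rewrite -scalemxAl mxE /s invrN mulNr mulVf // lt_eqF.
have zb : (z *m b) 0 0 < 0 by rewrite -scalemxAl mxE pmulr_rlt0.
pose c := col j A.
have xc (x : 'rV_k) : (x *m c) 0 0 = (x *m A) 0 j.
  by rewrite /c colE mulmxA -colE !mxE.
have proj m (M : 'M_(k, m)) (x : 'rV_k) :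
    x *m (M + c *m (z *m M)) = (x + (x *m c) 0 0 *: z) *m M.
  rewrite mulmxDr mulmxDl mulmxA [x *m c]mx11_scalar !mxE eqxx mulr1n.
  by rewrite mul_scalar_mx scalemxAl.
have H2 (x : 'rV_k) : (forall i, i \in T :\ j ->
  0 <= (x *m (A + c *m (z *m A))) 0 i) ->
    0 <= (x *m (b + c *m (z *m b))) 0 0.
  rewrite !proj => Hx; apply: H => i iT.
  have [->|ij] := eqVneq i j; last by apply: Hx; rewrite in_setD1 ij.
  by rewrite mulmxDl -scalemxAl mxE [X in _ + X]mxE zj xc; lra.
have [a [a0 aT ab]] := IHN _ _ _ TjN H2.
(* Solving the projected system for [b] shows that [r] is the coefficient that column [j] must
   receive. *)
pose r := (z *m A *m a) 0 0 - (z *m b) 0 0.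
have r0 : 0 <= r.
  rewrite subr_ge0; apply: (le_trans (ltW zb)).
  rewrite mxE sumr_ge0 // => i _.
  have [iT|iT] := boolP (i \in T :\ j); last by rewrite aT // mulr0.
  rewrite mulr_ge0 // -scalemxAl mxE mulr_ge0 ?(ltW s0) //.
  exact: x0T.
exists (a + r *: delta_mx j 0); split=> [i|i iT|].
- by rewrite !mxE addr_ge0 // mulr_ge0 //; case: (_ && _).
- rewrite !mxE aT ?in_setD1 ?negb_and ?iT ?orbT // add0r.
  by case: eqP => [ij|]; [move: iT; rewrite ij jT | rewrite mulr0].
rewrite mulmxDr -scalemxAr -colE -/c.
apply: (addIr (c *m (z *m b))); rewrite -ab mulmxDl -!mulmxA -addrA.
have c1 (M : 'M_1) : c *m M = M 0 0 *: c by rewrite {1}[M]mx11_scalar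
  mul_mx_scalar.
by rewrite !c1 -scalerDl /r mulmxA subrK.
Qed.

(** Linear independence of the columns in [S], phrased by vectors supported on [S]: its negation
    directly gives the dependency that the Caratheodory reduction subtracts. *)
Definition indep k n (A : 'M[R]_(k, n)) (S : {set 'I_n}) : Prop :=
  forall z : 'cV[R]_n, (forall i, i \notin S -> z i 0 = 0) -> A *m z = 0 ->
    z = 0.

Lemma mul_rowsub1 n m (f : 'I_m -> 'I_n) (v : 'rV[R]_m) j : injective f ->
  (v *m rowsub f 1%:M) 0 (f j) = v 0 j.
Proof.
move=> injf; rewrite mxE (bigD1 j) //= !mxE eqxx mulr1 big1 ?addr0 //.
by move=> i ij; rewrite !mxE (inj_eq injf) (negPf ij) mulr0.
Qed.

Lemma mul_rowsub1_notin n m (f : 'I_m -> 'I_n) (v : 'rV[R]_m) i :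
  (forall j, f j != i) -> (v *m rowsub f 1%:M) 0 i = 0.
Proof.
by move=> fi; rewrite mxE big1 // => j _; rewrite !mxE (negPf (fi j)) mulr0.
Qed.

Lemma indep_row_free k n (A : 'M[R]_(k, n)) (S : {set 'I_n}) m
    (f : 'I_m -> 'I_n) :
  injective f -> (forall j, f j \in S) -> indep A S -> row_free (rowsub f A^T).
Proof.
move=> injf fS iA.
rewrite -kermx_eq0; apply/rowV0P => v; rewrite sub_kermx => /eqP vA.
have z0 : (v *m rowsub f 1%:M)^T = 0.
  apply: iA => [i iS|].
    by rewrite mxE mul_rowsub1_notin // => j; apply: contraNneq iS => <-.
  apply: trmx_inj; rewrite trmx_mul trmxK trmx0 -mulmxA.
  by rewrite -rowsubE.
apply/rowP => j; rewrite -(mul_rowsub1 v j injf).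
by move/colP/(_ (f j)): z0; rewrite !mxE.
Qed.

Lemma indep_card k n (A : 'M[R]_(k, n)) (S : {set 'I_n}) :
  indep A S -> (#|S| <= k)%N.
Proof.
move=> /(indep_row_free enum_val_inj (@enum_valP _ (mem S))) /eqP <-.
by rewrite rank_leq_col.
Qed.

(** Subtract the multiple of [z] given by the smallest ratio [a i / z i] over the positive [z i]: no
    coordinate becomes negative and the minimizing one vanishes. *)
Lemma cone_reduce k n (A : 'M[R]_(k, n)) (a z : 'cV[R]_n) :
    (forall i, 0 <= a i 0) -> (forall i, a i 0 = 0 -> z i 0 = 0) ->
    A *m z = 0 -> (exists i, 0 < z i 0) ->
  exists a' : 'cV[R]_n, [/\ forall i, 0 <= a' i 0, A *m a' = A *m a &
    [set i | a' i 0 != 0] \proper [set i | a i 0 != 0]].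
Proof.
move=> a0 az Az [i0 zi0].
have [i zi imin] := @arg_minP _ _ _ i0 (fun i => 0 < z i 0) (fun i => a i 0 / z
  i 0) zi0.
pose t := a i 0 / z i 0.
have t0 : 0 <= t by rewrite divr_ge0 ?a0 ?ltW.
exists (a - t *: z); split=> [j||].
- rewrite !mxE subr_ge0.
  have [zj|zj] := ltP 0 (z j 0); first by rewrite -ler_pdivlMr ?imin.
  by apply: le_trans (a0 j); rewrite mulr_ge0_le0.
- by rewrite mulmxBr -scalemxAr Az scaler0 subr0.
apply/properP; split.
  apply/subsetP => j; rewrite !inE !mxE; apply: contraNN => /eqP aj.
  by rewrite aj (az _ aj) mulr0 subrr.
exists i; rewrite !inE.
  by apply: contraTneq zi => /az ->; rewrite ltxx.
by rewrite !mxE /t mulfVK ?(negbT (gt_eqF zi)) // subrr eqxx.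
Qed.

(** Farkas gives some nonnegative solution; as long as its support is dependent, [cone_reduce]
    applied to a dependency or its negative shrinks the support. *)
Lemma caratheodory k n (A : 'M[R]_(k, n)) (T : {set 'I_n}) (b : 'cV[R]_k) :
    (forall x : 'rV_k, (forall i, i \in T -> 0 <= (x *m A) 0 i) ->
       0 <= (x *m b) 0 0) ->
  exists (a : 'cV[R]_n) (S : {set 'I_n}),
    [/\ S \subset T, indep A S, forall i, i \in S -> 0 < a i 0,
        forall i, i \notin S -> a i 0 = 0 & A *m a = b].
Proof.
move=> /farkas[a [a0 aT ab]].
pose S (a : 'cV[R]_n) := [set i | a i 0 != 0].
suff [a' [a'0 a'b a'S iS]] : exists a' : 'cV[R]_n,
    [/\ forall i, 0 <= a' i 0, A *m a' = b, S a' \subset S a & indep A (S a')].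
  exists a', (S a'); split=> // [|i|i].
  - apply: (subset_trans a'S); apply/subsetP => i; rewrite inE.
    by apply: contraNT => /aT ->.
  - by rewrite inE lt0r a'0 andbT.
  - by rewrite inE negbK => /eqP.
move: {2}_.+1 (ltnSn #|S a|) => N.
elim: N a {aT} a0 ab => // N IHN a a0 ab aN.
have [iS|/existsNP[z /not_implyP[zS /not_implyP[Az /eqP z0]]]] :=
  pselect (indep A (S a)); first by exists a.
suff [a' [a'0 a'b a'S]] : exists a' : 'cV[R]_n,
    [/\ forall i, 0 <= a' i 0, A *m a' = A *m a & S a' \proper S a].
  have a'N : (#|S a'| < N)%N by rewrite -ltnS (leq_trans _ aN) // ltnS
    proper_card.
  have [c [c0 cb cS iS]] := IHN _ a'0 (etrans a'b ab) a'N.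
  by exists c; split=> //; apply: subset_trans cS (proper_sub a'S).
have za i : a i 0 = 0 -> z i 0 = 0 by move=> ai; apply: zS; rewrite inE ai eqxx.
have /cV0Pn[i zi] := z0.
case: (ltrgtP 0 (z i 0)) zi => // zi _.
  by apply: (cone_reduce a0 za Az); exists i.
have [|||a' ?] := @cone_reduce _ _ A a (- z) a0; last by exists a'.
- by move=> j /za; rewrite mxE => ->; rewrite oppr0.
- by rewrite mulmxN Az oppr0.
- by exists i; rewrite mxE oppr_gt0.
Qed.

End Farkas.

(** * Coedges of a Gale configuration *)

Section Gale.
Context {R : realFieldType}.

Definition negset n (l : 'rV[R]_n) : {set 'I_n} := [set i | l 0 i < 0].

(** The rows of [K] are a basis of the space [D] of dependencies and its columns are the vectors
    [g_i]; [x] is both a coordinate vector for [D] and a linear functional evaluated on the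
    [g_i]. *)
Definition gale k n (K : 'M[R]_(k, n)) : Prop :=
  forall x : 'rV_k, x != 0 -> (1 < #|negset (x *m K)|)%N.

Definition coedges k n (K : 'M[R]_(k, n)) : {set {set 'I_n}} :=
  [set e : {set 'I_n} | (#|e| == 2%N) && `[< exists x : 'rV_k,
    negset (x *m K) = e >]].

Definition coedges_at k n (K : 'M[R]_(k, n)) (u : 'I_n) : {set {set 'I_n}} :=
  [set e in coedges K | u \in e].

Lemma coedgesP k n (K : 'M[R]_(k, n)) (e : {set 'I_n}) :
  reflect (#|e| = 2%N /\ exists x : 'rV_k,
    negset (x *m K) = e) (e \in coedges K).
Proof.
rewrite inE; apply: (iffP andP) => [[/eqP ? /asboolP]//|[/eqP ? ?]].
by split=> //; apply/asboolP.
Qed.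

Lemma mulmx_colE k n (x : 'rV[R]_k) (K : 'M[R]_(k, n)) u :
  (x *m col u K) 0 0 = (x *m K) 0 u.
Proof. by rewrite colE mulmxA -colE mxE. Qed.

Lemma comb_eq k n (K : 'M[R]_(k, n)) (a : 'cV[R]_n) (u : 'I_n) (x : 'rV_k) :
  K *m a = col u K -> (x *m K) 0 u = \sum_i (x *m K) 0 i * a i 0.
Proof. by move=> Ka; rewrite -mulmx_colE -Ka mulmxA mxE. Qed.

Lemma coedge_pair k n (K : 'M[R]_(k, n)) (u : 'I_n) (e : {set 'I_n}) :
  e \in coedges_at K u -> exists2 v, v != u & e = [set u; v].
Proof.
rewrite inE => /andP[/coedgesP[/eqP e2 _] ue].
move: e2; rewrite (cardsD1 u) ue add1n eqSS => /cards1P[v ev].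
exists v; last by rewrite -(setD1K ue) ev.
by have := set11 v; rewrite -ev in_setD1 => /andP[].
Qed.

(** A functional that is negative at a nonnegative combination is negative at one of the vectors
    that enter it. *)
Lemma coedge_mem_comb k n (K : 'M[R]_(k, n)) (a : 'cV[R]_n) (u : 'I_n) (e :
  {set 'I_n}) :
    (forall i, 0 <= a i 0) -> a u 0 = 0 -> K *m a = col u K ->
    e \in coedges_at K u ->
  exists v, [/\ v != u, a v 0 != 0 & e = [set u; v]].
Proof.
move=> a0 au Ka eu; have [v vu ev] := coedge_pair eu.
exists v; split=> //; apply/eqP => av.
move: eu; rewrite inE => /andP[/coedgesP[_ [x xe]] ue].
have: u \in negset (x *m K) by rewrite xe.
rewrite inE ltNge (comb_eq _ Ka) sumr_ge0 // => i _.
have [|ie] := boolP (i \in e).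
  by rewrite ev !inE => /orP[/eqP->|/eqP->]; rewrite ?au ?av mulr0.
by move: ie; rewrite -xe inE -leNgt => xi; rewrite mulr_ge0.
Qed.

Lemma card_coedges_at_comb k n (K : 'M[R]_(k, n)) (a : 'cV[R]_n) (u : 'I_n)
    (S : {set 'I_n}) :
    (forall i, 0 <= a i 0) -> u \notin S -> (forall i, i \notin S ->
      a i 0 = 0) ->
    K *m a = col u K ->
  coedges_at K u \subset [set [set u; v] | v in S].
Proof.
move=> a0 uS aS Ka; apply/subsetP => e /(coedge_mem_comb a0 (aS _ uS) Ka).
move=> [v [_ av ->]]; apply: imset_f.
by apply: contraNT av => /aS ->.
Qed.

(** A functional that separates column [u] from the cone of the other columns would be negative at
    [u] only, which [gale] forbids; hence Caratheodory applies. *)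
Lemma gale_comb k n (K : 'M[R]_(k, n)) (u : 'I_n) : gale K ->
  exists (a : 'cV[R]_n) (S : {set 'I_n}),
    [/\ u \notin S, indep K S, forall i, i \in S -> 0 < a i 0,
        forall i, i \notin S -> a i 0 = 0 & K *m a = col u K].
Proof.
move=> gK.
have [|a [S [Su iS aS aS0 Ka]]] := @caratheodory _ _ _ K [set~ u] (col u K).
  move=> x Hx; rewrite mulmx_colE leNgt; apply/negP => xu.
  have x0 : x != 0 by apply: contraTneq xu => ->; rewrite mul0mx mxE ltxx.
  have := gK x x0; rewrite ltnNge => /negP; apply.
  apply: (@leq_trans #|[set u]|); last by rewrite cards1.
  apply/subset_leq_card/subsetP => i.
  by rewrite !inE; apply: contraTT => iu; rewrite -leNgt Hx // !inE.
exists a, S; split=> //; apply/negP => /(subsetP Su).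
by rewrite !inE eqxx.
Qed.

Lemma pos_on_ge0 n (a : 'cV[R]_n) (S : {set 'I_n}) :
    (forall i, i \in S -> 0 < a i 0) -> (forall i, i \notin S -> a i 0 = 0) ->
  forall i, 0 <= a i 0.
Proof.
by move=> aS aS0 i; have [/aS/ltW//|/aS0->] := boolP (i \in S).
Qed.

Lemma card_coedges_at k n (K : 'M[R]_(k, n)) (u : 'I_n) :
  gale K -> (#|coedges_at K u| <= k)%N.
Proof.
move=> /(gale_comb u)[a [S [uS iS aS aS0 Ka]]].
apply: leq_trans (indep_card iS).
apply: leq_trans (leq_imset_card (fun v => [set u; v]) S).
by apply/subset_leq_card/(card_coedges_at_comb _ uS aS0 Ka)/pos_on_ge0/aS0.
Qed.

Lemma leq_card_bigcup (I T : finType) (P : {set I}) (F : I -> {set T}) :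
  (#|\bigcup_(i in P) F i| <= \sum_(i in P) #|F i|)%N.
Proof.
elim/big_ind2: _ => [|A m B p Am Bp|//]; first by rewrite cards0.
by rewrite (leq_trans (leq_card_setU _ _)) // leq_add.
Qed.

(** The hypothesis says that the columns in [T] positively span the space. A coedge disjoint from
    [T] would be realized by the zero functional, which has no negative value. *)
Lemma card_coedges_hitting k n (K : 'M[R]_(k, n)) (T : {set 'I_n}) :
    (forall x : 'rV_k, (forall t, t \in T -> 0 <= (x *m K) 0 t) -> x = 0) ->
  (#|coedges K| <= \sum_(t in T) #|coedges_at K t|)%N.
Proof.
move=> hT; apply: leq_trans (leq_card_bigcup _ _).
apply/subset_leq_card/subsetP => e eK.
have /coedgesP[e2 [x xe]] := eK.
have [t /andP[tT te]|tn] := pickP [pred t in T | t \in e].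
  by apply/bigcupP; exists t => //; rewrite inE eK.
have x0 : x = 0.
  apply: hT => t tT; move: (tn t); rewrite /= tT -xe inE /=.
  by move=> /negbT; rewrite -leNgt.
move: e2; rewrite -xe x0 mul0mx (_ : negset 0 = set0) ?cards0 //.
by apply/setP => i; rewrite !inE mxE ltxx.
Qed.

Lemma card_coedges_hitting_le k n (K : 'M[R]_(k, n)) (T : {set 'I_n}) c :
    (forall x : 'rV_k, (forall t, t \in T -> 0 <= (x *m K) 0 t) -> x = 0) ->
    (forall u, #|coedges_at K u| <= c)%N ->
  (#|coedges K| <= #|T| * c)%N.
Proof.
move=> /card_coedges_hitting le dc; apply: leq_trans le _.
by rewrite -sum_nat_const leq_sum.
Qed.

(** Evaluating [x] on both sides of [K *m a = - col u K] gives a sum of nonnegative terms that is at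
    most 0, so each term vanishes. Thus [S] and [u] together positively span the linear span of
    [S]. *)
Lemma ge0_opp_comb k n (K : 'M[R]_(k, n)) (a : 'cV[R]_n) (u : 'I_n)
    (S : {set 'I_n}) (x : 'rV_k) :
    (forall i, i \in S -> 0 < a i 0) -> (forall i, i \notin S -> a i 0 = 0) ->
    K *m a = - col u K ->
    0 <= (x *m K) 0 u -> (forall i, i \in S -> 0 <= (x *m K) 0 i) ->
  forall i, i \in S -> (x *m K) 0 i = 0.
Proof.
move=> aS aS0 Ka xu xS.
have: \sum_(i in S) (x *m K) 0 i * a i 0 <= 0.
  rewrite -oppr_ge0; apply: le_trans xu _.
  rewrite -mulmx_colE -[col u K]opprK -Ka mulmxN mulmxA mxE lerN2 mxE.
  rewrite [leRHS](bigID (mem S)) /= [X in _ <= _ + X]big1 ?addr0 //.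
  by move=> i /aS0 ->; rewrite mulr0.
rewrite le_eqVlt ltNge sumr_ge0 ?orbF => [|i iS]; last first.
  by rewrite mulr_ge0 ?xS // ltW ?aS.
rewrite psumr_eq0 => [/allP H i iS|i iS]; last first.
  by rewrite mulr_ge0 ?xS // ltW ?aS.
have := H i (mem_index_enum _); rewrite iS mulf_eq0 => /orP[/eqP//|].
by rewrite gt_eqF ?aS.
Qed.

(** The set [S] with [u] positively spans a space of dimension 2 or 3. In dimension 3 it has four
    elements and suffices; in dimension 2 it has three, and one vector on each side of the plane is
    added. Five vectors with two coedges each give 10. *)
Lemma coedges_le10_of_opp_comb n (K : 'M[R]_(3, n)) (a : 'cV[R]_n) (u : 'I_n)
    (S : {set 'I_n}) :
    gale K -> (forall u, #|coedges_at K u| <= 2)%N ->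
    indep K S -> (1 < #|S|)%N -> (forall i, i \in S -> 0 < a i 0) ->
    (forall i, i \notin S -> a i 0 = 0) -> K *m a = - col u K ->
  (#|coedges K| <= 10)%N.
Proof.
move=> gK d2 iS S1 aS aS0 Ka.
suff [T T5 hT] : exists2 T : {set 'I_n}, (#|T| <= 5)%N &
    forall x : 'rV_3, (forall t, t \in T -> 0 <= (x *m K) 0 t) -> x = 0.
  by apply: leq_trans (card_coedges_hitting_le hT d2) _;
    rewrite (leq_mul2r 2 _ 5).
pose A := (rowsub (@enum_val _ (mem S)) K^T)^T.
have rA : \rank A = #|S| by rewrite mxrank_tr;
  apply/eqP/(indep_row_free enum_val_inj (@enum_valP _ _) iS).
have S3 := indep_card iS.
have kerA (x : 'rV_3) : (forall i, i \in S -> (x *m K) 0 i = 0) ->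
    (x <= kermx A)%MS.
  move=> xS; rewrite sub_kermx; apply/eqP/rowP => j; rewrite mxE [RHS]mxE.
  apply: (etrans _ (xS _ (enum_valP j))); rewrite [RHS]mxE;
    apply: eq_bigr => i _.
  by rewrite !mxE.
have rker : \rank (kermx A) = (3 - #|S|)%N by rewrite mxrank_ker rA.
have [ker0|ker0] := eqVneq (kermx A) 0.
  exists (u |: S) => [|x xT].
    by rewrite cardsU1; case: (_ \notin _); lia.
  apply/eqP; rewrite -submx0 -ker0; apply: kerA.
  apply: (ge0_opp_comb aS aS0 Ka) => [|i iS']; first by rewrite xT ?setU11.
  by rewrite xT // setU1r.
(* Here [S] has two elements, and the functionals that vanish on [S] form the line through [x0]. *)
pose x0 := nz_row (kermx A).
have x00 : x0 != 0 by rewrite nz_row_eq0.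
have kerx0 : (kermx A <= x0)%MS.
  have := mxrank_leqif_sup (nz_row_sub (kermx A)); rewrite -/x0 => -[_ <-].
  rewrite rker rank_rV x00; apply/eqP.
  by move: ker0; rewrite -mxrank_eq0 rker; lia.
have pickneg (x : 'rV_3) : x != 0 -> exists w, (x *m K) 0 w < 0.
  by move=> /gK/ltnW/card_gt0P[w]; rewrite inE; exists w.
have [w xw] := pickneg _ x00.
have [w' xw'] : exists w', (- x0 *m K) 0 w' < 0 by apply: pickneg;
  rewrite oppr_eq0.
exists (u |: (S :|: [set w; w'])).
  have: (0 < \rank (kermx A))%N by rewrite lt0n mxrank_eq0.
  rewrite rker => S2; rewrite cardsU1.
  have := leq_of_leqif (leq_card_setU S [set w; w']); rewrite cards2.
  move: S2 S1 S3; move: #|S :|: _| #|S| => c s.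
  by case: (w != w'); case: (_ \notin _) => /=; lia.
move=> x xT.
have /sub_rVP[c xc] : (x <= x0)%MS.
  apply: (submx_trans _ kerx0); apply: kerA.
  apply: (ge0_opp_comb aS aS0 Ka) => [|i iS']; first by rewrite xT ?setU11.
  by rewrite xT // setU1r // inE iS'.
have := xT w; rewrite !inE eqxx !orbT => /(_ isT).
have := xT w'; rewrite !inE eqxx !orbT => /(_ isT).
move: xw'; rewrite mulNmx mxE oppr_lt0 => xw'.
rewrite xc -scalemxAl mxE [in X in _ -> X -> _]mxE.
rewrite pmulr_lge0 // => c0; rewrite nmulr_lge0 // => c0'.
have -> : c = 0 by lra.
by rewrite scale0r.
Qed.
End Gale.

(** * At most two coedges at each vertex *)

Section SmallDegree.
Context {R : realFieldType}.

Lemma gale_row_free k n (K : 'M[R]_(k, n)) : gale K -> row_free K.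
Proof.
move=> gK; rewrite -kermx_eq0; apply/rowV0P => x; rewrite sub_kermx => /eqP xK.
apply/eqP; apply/negPn/negP => /gK; rewrite xK.
by rewrite (_ : negset 0 = set0) ?cards0 //; apply/setP => i;
  rewrite !inE mxE ltxx.
Qed.

Lemma coedges_at_col0 k n (K : 'M[R]_(k, n)) u :
  col u K = 0 -> coedges_at K u = set0.
Proof.
move=> u0; apply/setP => e; rewrite [RHS]inE inE; apply/negP.
move=> /andP[/coedgesP[_ [x <-]]]; rewrite inE -mulmx_colE u0 mulmx0 mxE.
by rewrite ltxx.
Qed.

Definition opposites k n (K : 'M[R]_(k, n)) (w : 'I_n) : {set 'I_n} :=
  [set v | `[< exists2 a, 0 < a & col v K = - (a *: col w K) >]].

Lemma oppositesP k n (K : 'M[R]_(k, n)) (w v : 'I_n) :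
  reflect (exists2 a, 0 < a & col v K = - (a *: col w K)) (v \in opposites K w).
Proof. by rewrite inE; apply: asboolP. Qed.

Lemma mulmx_single k n (K : 'M[R]_(k, n)) (a : 'cV[R]_n) (t : 'I_n) :
  (forall i, i != t -> a i 0 = 0) -> K *m a = a t 0 *: col t K.
Proof.
move=> a0; apply/colP => j; rewrite !mxE (bigD1 t) //= mulrC big1 ?addr0 // =>
  i it.
by rewrite a0 // mulr0.
Qed.

(** If [- col w K] were in the cone of the columns that are not opposite to [w], it would by
    hypothesis be a multiple of a single one, which would then be opposite. So a functional
    separates, its negative coordinates all lie in [opposites K w], and [gale] provides two of
    them. *)
Lemma card_opposites k n (K : 'M[R]_(k, n)) (w : 'I_n) :
    gale K -> col w K != 0 ->
    (forall (a : 'cV[R]_n) (u : 'I_n) (S : {set 'I_n}),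
      indep K S -> (forall i, i \in S -> 0 < a i 0) ->
      (forall i, i \notin S -> a i 0 = 0) -> K *m a = - col u K ->
      (#|S| <= 1)%N) ->
  (1 < #|opposites K w|)%N.
Proof.
move=> gK w0 H.
have [H1|/existsNP[x /not_implyP[xO /negP]]] := pselect (forall x : 'rV_k,
    (forall i, i \in ~: opposites K w -> 0 <= (x *m K) 0 i) ->
    0 <= (x *m - col w K) 0 0).
  have [a [S [SO iS aS aS0 Ka]]] := caratheodory H1.
  have := H _ _ _ iS aS aS0 Ka; rewrite leq_eqVlt ltnS leqn0 cards_eq0.
  case/orP => [/cards1P[t St]|/eqP S0]; last first.
    move: w0; rewrite -oppr_eq0 -Ka (_ : a = 0) ?mulmx0 ?eqxx //.
    by apply/colP => i; rewrite aS0 ?mxE // S0 inE.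
  have at0 : 0 < a t 0 by rewrite aS // St set11.
  have := subsetP SO t; rewrite St set11 in_setC => /(_ isT)/oppositesP[].
  exists (a t 0)^-1; first by rewrite invr_gt0.
  rewrite -scalerN -Ka (@mulmx_single _ _ _ _ t) => [|i it]; last first.
    by rewrite aS0 // St inE.
  by rewrite scalerA mulVf ?scale1r // gt_eqF.
rewrite mulmxN mxE oppr_ge0 mulmx_colE -ltNge => xw.
have /gK : x != 0 by apply: contraTneq xw => ->; rewrite mul0mx mxE ltxx.
move=> /leq_trans; apply; apply/subset_leq_card/subsetP => i.
by apply: contraTT => iO; rewrite inE -leNgt xO // in_setC.
Qed.

Lemma coedges_le10_deg2 n (K : 'M[R]_(3, n)) :
  gale K -> (forall u, #|coedges_at K u| <= 2)%N -> (#|coedges K| <= 10)%N.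
Proof.
move=> gK d2.
have [[a [u [S [iS S1 [aS aS0 Ka]]]]]|H] := pselect
    (exists (a : 'cV[R]_n) (u : 'I_n) (S : {set 'I_n}),
      [/\ indep K S, (1 < #|S|)%N & [/\ forall i, i \in S -> 0 < a i 0,
        forall i, i \notin S -> a i 0 = 0 & K *m a = - col u K]]).
  exact: coedges_le10_of_opp_comb gK d2 iS S1 aS aS0 Ka.
have opp2 (w : 'I_n) : col w K != 0 -> (1 < #|opposites K w|)%N.
  move=> w0; apply: (card_opposites gK w0) => a u S iS aS aS0 Ka.
  by rewrite leqNgt; apply/negP => S1; apply: H; exists a, u, S.
(* An opposite [t] of [u] has a second opposite [v] besides [u]; column [u] is then a positive
   multiple of column [v], so every coedge at [u] is [{u, v}]. *)
have d1 u : (#|coedges_at K u| <= 1)%N.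
  have [/coedges_at_col0 ->|u0] := eqVneq (col u K) 0; first by rewrite cards0.
  have /ltnW/card_gt0P[t /oppositesP[s s0 tu]] := opp2 u u0.
  have t0 : col t K != 0 by rewrite tu oppr_eq0 scaler_eq0 negb_or gt_eqF.
  have /card_gt0P[v] : (0 < #|opposites K t :\ u|)%N.
    have := opp2 t t0; rewrite (cardsD1 u).
    by case: (u \in opposites K t); rewrite ?add1n ?add0n ?ltnS // => /ltnW.
  rewrite in_setD1 => /andP[vu /oppositesP[r r0 vt]].
  have sub := @card_coedges_at_comb _ _ _ K ((r * s)^-1 *: delta_mx v 0) u [set
    v].
  apply: leq_trans (subset_leq_card (sub _ _ _ _)) _.
  - by move=> i; rewrite !mxE mulr_ge0 ?ler0n // ltW // invr_gt0 mulr_gt0.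
  - by rewrite inE eq_sym.
  - by move=> i; rewrite !inE !mxE => /negPf ->; rewrite mulr0.
  - rewrite -scalemxAr -colE vt tu !scalerN opprK !scalerA -mulrA mulVf
    ?scale1r //.
    by rewrite mulf_eq0 negb_or !gt_eqF.
  by rewrite imset_set1 cards1.
(* Three columns [f i] that form a basis, together with one opposite [o i] of each, positively span
   the space: at most six vectors, each in at most one coedge. *)
have fK : row_full K^T by rewrite /row_full mxrank_tr; apply: gale_row_free.
pose f := fullrankfun fK.
have f0 i : col (f i) K != 0.
  apply/eqP => fi0.
  have := fullrowsub_free fK => /row_freeP[B /(congr1 (row i))].
  rewrite row_mul (_ : row i _ = 0) ?mul0mx; last first.
    apply/rowP => j; move/colP/(_ j): fi0; rewrite !mxE; apply.
  by move=> /rowP/(_ i)/esym/eqP; rewrite !mxE eqxx oner_eq0.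
have /fin_all_exists[o oP] (i : 'I_3) : exists t, t \in opposites K (f i).
  by have /ltnW/card_gt0P[t] := opp2 _ (f0 i); exists t.
pose T := f @: 'I_3 :|: o @: 'I_3.
apply: (@leq_trans (#|T| * 1)).
  apply: card_coedges_hitting_le d1 => x xT.
  have xf i : (x *m K) 0 (f i) = 0.
    apply/eqP; rewrite eq_le xT ?andbT; last by rewrite inE imset_f.
    have /oppositesP[a a0 oa] := oP i.
    have: 0 <= (x *m K) 0 (o i) by rewrite xT // inE imset_f ?orbT.
    rewrite -mulmx_colE oa mulmxN -scalemxAr mxE mxE oppr_ge0 mulmx_colE.
    by rewrite pmulr_rle0.
  apply: trmx_inj; rewrite trmx0.
  have fu := fullrowsub_unit fK.
  apply: (can_inj (mulKmx fu)); rewrite mulmx0.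
  by apply/colP => i; rewrite [RHS]mxE -[RHS](xf i) !mxE;
    apply: eq_bigr => j _; rewrite !mxE mulrC.
rewrite muln1 (leq_trans (leq_card_setU _ _)) //.
by rewrite (leq_trans (leq_add (leq_imset_card _ _) (leq_imset_card _ _))) //
  card_ord.
Qed.
End SmallDegree.

(** * A vertex in three coedges *)

Section Star.
Context {R : realFieldType}.

(** Column [u] is (1, 1, 1), the columns [v i] lie on the positive coordinate axes, and all others
    lie in the nonpositive octant. The [v i] are only multiples of basis vectors, because a change
    of basis of the row space cannot rescale single columns. *)
Definition star n (G : 'M[R]_(3, n)) (u : 'I_n) (v : 'I_3 -> 'I_n) : Prop :=
  [/\ injective v, forall i, v i != u,
      forall i, 0 < G i (v i), forall i j, i != j -> G i (v j) = 0
    & (forall i, G i u = 1) /\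
      forall i w, w != u -> (forall j, v j != w) -> G i w <= 0].

Lemma coedges_unit k n (A : 'M[R]_k) (K : 'M[R]_(k, n)) :
  A \in unitmx -> coedges (A *m K) = coedges K.
Proof.
move=> uA; apply/setP => e; apply/coedgesP/coedgesP => -[e2 [x xe]]; split=> //.
  by exists (x *m A); rewrite -mulmxA.
by exists (x *m invmx A); rewrite mulmxA mulmxKV.
Qed.

Lemma gale_unit k n (A : 'M[R]_k) (K : 'M[R]_(k, n)) :
  A \in unitmx -> gale K -> gale (A *m K).
Proof.
move=> uA gK x x0; rewrite mulmxA; apply: gK.
by apply: contraNneq x0 => xA; rewrite -(mulmxK uA x) xA mul0mx.
Qed.

Lemma enum_set_card (T : finType) (S : {set T}) m : #|S| = m ->
  exists2 v : 'I_m -> T, injective v & forall t, t \in S <-> exists i, t = v i.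
Proof.
move=> <-; exists (@enum_val _ (mem S)); first exact: enum_val_inj.
move=> t; split=> [tS|[i ->]]; last exact: enum_valP.
by exists (enum_rank_in tS t); rewrite enum_rankK_in.
Qed.

(** The columns in the support of a combination for [u] form a basis, scaled so that all
    coefficients of [u] become 1. The sign condition on the remaining columns comes from the three
    coedges [{u, v i}]. *)
Lemma star_of_degree3 n (K : 'M[R]_(3, n)) (u : 'I_n) :
    gale K -> #|coedges_at K u| = 3%N ->
  exists (A : 'M[R]_3) (v : 'I_3 -> 'I_n), A \in unitmx /\ star (A *m K) u v.
Proof.
move=> gK du; have [a [S [uS iS aS aS0 Ka]]] := gale_comb u gK.
have sub := card_coedges_at_comb (pos_on_ge0 aS aS0) uS aS0 Ka.
have S3 : #|S| = 3%N.
  apply/eqP; rewrite eqn_leq (indep_card iS) -du.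
  exact: leq_trans (subset_leq_card sub) (leq_imset_card _ _).
(* Three coedges at [u] is equality in the bound by [S], so every element of [S] is paired with
   [u]. *)
have Kv w : w \in S -> [set u; w] \in coedges_at K u.
  move=> wS; have /eqP -> : coedges_at K u == [set [set u; v] | v in S].
    by rewrite eqEcard sub du -S3 leq_imset_card.
  exact: imset_f.
have [v injv vS] := enum_set_card S3.
have vSi i : v i \in S by apply/vS; exists i.
have vu i : v i != u by apply: contraNneq uS => <-.
pose M := (rowsub v K^T)^T.
have uM : M \in unitmx by rewrite unitmx_tr -row_free_unit (indep_row_free injv
  vSi iS).
pose D : 'M[R]_3 := diag_mx (\row_i (a (v i) 0)^-1).
have av i : 0 < a (v i) 0 by apply: aS.
have uD : D \in unitmx.
  rewrite unitmxE det_diag unitfE; apply/prodf_neq0 => i _.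
  by rewrite mxE invr_eq0 gt_eqF.
pose A := D *m invmx M.
have uA : A \in unitmx by rewrite unitmx_mul uD unitmx_inv.
exists A, v; split=> //; set G := A *m K.
have Gv i j : G i (v j) = (a (v i) 0)^-1 * (i == j)%:R.
  have -> : G i (v j) = (A *m M) i j.
    by rewrite !mxE; apply: eq_bigr => l _; rewrite !mxE.
  by rewrite /A mulmxKV // mxE mxE mulr_natr.
have Gu i : G i u = 1.
  have : G *m a = col u G by rewrite /G -mulmxA Ka !colE mulmxA.
  move=> /colP/(_ i); rewrite [in RHS]mxE => <-; rewrite mxE.
  rewrite (bigD1 (v i)) //= Gv eqxx mulr1 mulVf ?gt_eqF // big1 ?addr0 // => w
    wv.
  have [/vS[j wj]|/aS0->] := boolP (w \in S); last by rewrite mulr0.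
  have ij : i != j by apply: contraNneq wv => ->; rewrite wj.
  by rewrite wj Gv (negPf ij) mulr0 mul0r.
split=> // [i|i j ij|].
- by rewrite Gv eqxx mulr1 invr_gt0.
- by rewrite Gv (negPf ij) mulr0.
split=> // i0 w wu wv.
(* Suppose that the largest coordinate [G i w] is positive, and let [y] realize [{u, v i}]. The sum
   of the [y 0 j * (G i w - G j w)] is nonnegative termwise, but it equals [(\sum_j y 0 j) * G i w]
   minus the value of [y] at [w], hence is negative. *)
have [i _ imax] := @arg_maxP _ _ _ i0 predT (fun i => G i w) isT.
apply: le_trans (imax i0 isT) _; rewrite leNgt; apply/negP => Gi.
have : [set u; v i] \in coedges G.
  by rewrite coedges_unit //; have := Kv _ (vSi i); rewrite inE => /andP[].
case/coedgesP => _ [y yN].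
have yE x : (y *m G) 0 x = \sum_j y 0 j * G j x by rewrite mxE.
have yu : \sum_j y 0 j < 0.
  have : u \in negset (y *m G) by rewrite yN set21.
  by rewrite inE yE (eq_bigr (fun j => y 0 j)) // => j _; rewrite Gu mulr1.
have yw : 0 <= \sum_j y 0 j * G j w.
  rewrite -yE leNgt; have := in_set2 w u (v i).
  by rewrite -yN inE (negPf wu) eq_sym (negPf (wv i)) => ->.
have yj j : j != i -> 0 <= y 0 j.
  move=> ji; have := in_set2 (v j) u (v i).
  rewrite -yN inE (negPf (vu j)) (inj_eq injv) (negPf ji) => /negbT.
  rewrite -leNgt yE (bigD1 j) //= big1 ?addr0 => [|l lj].
    by rewrite Gv eqxx mulr1 pmulr_lge0 // invr_gt0.
  by rewrite Gv (negPf lj) !mulr0.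
have : 0 <= \sum_j y 0 j * (G i w - G j w).
  apply: sumr_ge0 => j _; have [->|ji] := eqVneq j i;
    first by rewrite subrr mulr0.
  by rewrite mulr_ge0 ?yj // subr_ge0; apply: imax.
under eq_bigr do rewrite mulrBr; rewrite sumrB -mulr_suml.
have := nmulr_rlt0 (G i w) yu; rewrite Gi; lra.
Qed.

End Star.

(** * Coedges in star coordinates *)

Section StarCount.
Context {R : realFieldType} {n : nat} {G : 'M[R]_(3, n)}.
Context {u : 'I_n} {v : 'I_3 -> 'I_n}.
Hypotheses (gG : gale G) (stG : star G u v).

Lemma ord3_all (i j k : 'I_3) :
  uniq [:: i; j; k] -> forall l, l \in [:: i; j; k].
Proof.
move=> uijk l.
have [||_ ->] := @uniq_min_size _ [:: i; j; k] (enum 'I_3) uijk.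
- by move=> t _; rewrite mem_enum.
- by rewrite size_enum_ord.
by rewrite mem_enum.
Qed.

Lemma ord3P (i j k : 'I_3) : uniq [:: i; j; k] ->
  forall l, [\/ l = i, l = j | l = k].
Proof.
by move=> uijk l; have := ord3_all uijk l; rewrite !inE => /or3P[]/eqP;
  constructor.
Qed.

Lemma sum_ord3 (V : nmodType) (F : 'I_3 -> V) (i j k : 'I_3) :
  uniq [:: i; j; k] -> \sum_l F l = F i + F j + F k.
Proof.
move=> uijk; rewrite -big_enum /= (perm_big [:: i; j; k]) /=.
  by rewrite !big_cons big_nil addr0 addrA.
apply: uniq_perm => // [|l]; first exact: enum_uniq.
by rewrite mem_enum (ord3_all uijk).
Qed.

Lemma ord3_third (i j : 'I_3) : i != j -> exists k, uniq [:: i; j; k].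
Proof.
move=> ij; have [k _ kP] : exists2 k, k \in 'I_3 & k \notin [set i; j].
  have : ~~ ([set: 'I_3] \subset [set i; j]).
    apply/negP => /subset_leq_card; by rewrite cardsT card_ord cards2;
      case: (_ != _).
  by case/subsetPn => k _ kP; exists k.
exists k; move: kP; rewrite /= !inE !negb_or ij andbT /=.
by rewrite ![k == _]eq_sym.
Qed.

(* This is the set called [S_i] above. *)
Definition outer i := negset (row i G).

Lemma outerE i w : (w \in outer i) = (G i w < 0).
Proof. by rewrite inE mxE. Qed.

Definition ucore := u |: [set v i | i : 'I_3].

Lemma v_core i : v i \in ucore.
Proof. by rewrite !inE imset_f ?orbT. Qed.

Lemma Gvv i : 0 < G i (v i). Proof. by case: stG. Qed.
Lemma Gvn i j : i != j -> G i (v j) = 0. Proof. by case: stG => ? ? ? H _;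
  apply: H. Qed.
Lemma Gu i : G i u = 1. Proof. by case: stG => ? ? ? ? []. Qed.
Lemma v_inj : injective v. Proof. by case: stG. Qed.
Lemma v_neq_u i : v i != u. Proof. by case: stG. Qed.

Lemma noncore_le0 i w : w \notin ucore -> G i w <= 0.
Proof.
case: stG => _ _ _ _ [_ H]; rewrite !inE negb_or => /andP[wu wv];
  apply: H => // j.
by apply: contraNneq wv => <-; rewrite imset_f.
Qed.

Lemma outer_noncore i w : w \in outer i -> w \notin ucore.
Proof.
rewrite outerE => Gw; rewrite !inE negb_or; apply/andP; split.
  by apply: contraTneq Gw => ->; rewrite Gu ltNge ler01.
apply: contraTN Gw => /imsetP[j _ ->]; rewrite -leNgt.
by have [->|ij] := eqVneq i j; [rewrite ltW ?Gvv|rewrite Gvn].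
Qed.

Lemma noncore_eq0 i w : w \notin ucore -> w \notin outer i -> G i w = 0.
Proof.
by move=> wc; rewrite outerE -leNgt => Gw; apply: le_anti; rewrite noncore_le0.
Qed.

Lemma starE (y : 'rV[R]_3) w : (y *m G) 0 w = \sum_j y 0 j * G j w.
Proof. by rewrite mxE. Qed.

Lemma starv (y : 'rV[R]_3) i : (v i \in negset (y *m G)) = (y 0 i < 0).
Proof.
rewrite inE starE (bigD1 i) //= big1 ?addr0 => [|j ji].
  by rewrite pmulr_llt0 ?Gvv.
by rewrite Gvn ?mulr0.
Qed.

Lemma staru (y : 'rV[R]_3) : (u \in negset (y *m G)) = (\sum_j y 0 j < 0).
Proof.
by rewrite inE starE; under eq_bigr do rewrite Gu mulr1.
Qed.

Lemma outer_negset i : negset (delta_mx 0 i *m G) = outer i.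
Proof. by rewrite -rowE. Qed.

Lemma card_outer i : (1 < #|outer i|)%N.
Proof.
rewrite -outer_negset; apply: gG; apply/eqP => /rowP/(_ i)/eqP.
by rewrite !mxE !eqxx oner_eq0.
Qed.

Lemma outer_coedge i : #|outer i| = 2%N -> outer i \in coedges G.
Proof. by move=> o2; apply/coedgesP; split=> //; exists (delta_mx 0 i);
  rewrite outer_negset. Qed.

Definition coedges_off_v : {set {set 'I_n}} :=
  [set e in coedges G | [forall i, v i \notin e]].

(** A functional [y] that realizes such a coedge has nonnegative coordinates, one of them positive,
    say the [i]-th. It is negative on all of [outer i], which has at least two elements and so fills
    the coedge. *)
Lemma coedge_off_v (e : {set 'I_n}) : e \in coedges_off_v ->
  exists i, e = outer i.
Proof.
rewrite inE => /andP[/coedgesP[e2 [y ye]] /forallP vN].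
have y0 j : 0 <= y 0 j by have := vN j; rewrite -ye starv -leNgt.
have [i yi] : exists i, y 0 i != 0.
  apply/rV0Pn; apply: contraPneq e2 => y00; rewrite -ye y00 mul0mx.
  by rewrite (_ : negset 0 = set0) ?cards0 //; apply/setP => i;
    rewrite !inE mxE ltxx.
exists i; apply/esym/eqP; rewrite eqEcard e2 card_outer andbT.
apply/subsetP => w wi; rewrite -ye inE starE.
have wc := outer_noncore wi.
rewrite (bigD1 i) //=; apply: ltr_wnDr.
  by apply: sumr_le0 => j _; rewrite mulr_ge0_le0 ?noncore_le0.
by rewrite pmulr_rlt0 ?lt0r ?yi ?y0 // -outerE.
Qed.

Lemma coedges_off_v_sub : coedges_off_v \subset [set outer i | i : 'I_3].
Proof. by apply/subsetP => e /coedge_off_v[i ->]; rewrite imset_f. Qed.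

Definition outers := \bigcup_i outer i.

Lemma outer_sub i : outer i \subset outers.
Proof. by apply/subsetP => w wi; apply/bigcupP; exists i. Qed.

Lemma outersE (i j k : 'I_3) :
  uniq [:: i; j; k] -> outers = outer i :|: outer j :|: outer k.
Proof.
move=> uijk; apply/setP => w; rewrite !inE.
apply/bigcupP/idP => [[l _ wl]|/orP[/orP[]|] ?]; last 3 first.
- by exists i; rewrite // inE.
- by exists j; rewrite // inE.
- by exists k; rewrite // inE.
have := ord3_all uijk l; rewrite !inE in wl *.
by move=> /or3P[] /eqP ll; rewrite ll in wl; rewrite wl ?orbT.
Qed.

(** Double counting of the incidences between coedges and their elements. *)
Lemma coedges_handshake (Z : {set 'I_n}) c :
    (forall e, e \in coedges G -> e \subset Z) ->
    (forall z, #|coedges_at G z| <= c)%N ->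
  (2 * #|coedges G| <= #|Z| * c)%N.
Proof.
move=> eZ dc; apply: (@leq_trans (\sum_(z in Z) #|coedges_at G z|)); last first.
  by rewrite -sum_nat_const leq_sum.
rewrite mulnC -sum_nat_const.
rewrite (eq_bigr (fun e : {set 'I_n} => \sum_(z in Z) (z \in e : nat)));
  last first.
  move=> e eE; have /coedgesP[e2 _] := eE; apply: (etrans (esym e2)).
  rewrite -sum1_card [RHS]big_mkcond [LHS]big_mkcond; apply: eq_bigr => z _.
  have := subsetP (eZ _ eE) z; case: (z \in e) => [->//|_].
  by case: ifP.
rewrite exchange_big; apply: leq_sum => z _.
rewrite -sum1_card big_mkcond [leqRHS]big_mkcond; apply: leq_sum => e _.
by rewrite !inE; case: (_ && _) => //=; case: (z \in e).
Qed.

(** Columns outside [ucore] and [outers] are zero and lie in no coedge. With at most three elements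
    in [outers], all coedges live on seven elements, each in at most three of them, which allows
    only 10. *)
Lemma card_outers : (10 < #|coedges G|)%N -> (3 < #|outers|)%N.
Proof.
move=> E10; rewrite ltnNge; apply/negP => U3.
have := @coedges_handshake (ucore :|: outers) 3 _ (fun z => card_coedges_at z
  gG).
have Z7 : (#|ucore :|: outers| <= 7)%N.
  rewrite (leq_trans (leq_card_setU _ _)) // (@leq_add _ _ 4 3) // cardsU1.
  by rewrite (@leq_add _ _ 1 3) ?leq_b1 // (leq_trans (leq_imset_card _ _))
    ?card_ord.
move=> H; have {}H : (2 * #|coedges G| <= #|ucore :|: outers| * 3)%N.
  apply: H => e /coedgesP[_ [y <-]]; apply/subsetP => w.
  rewrite in_setU; apply: contraTT; rewrite negb_or => /andP[wc wU].
  rewrite inE starE big1 ?ltxx // => j _; rewrite noncore_eq0 ?mulr0 //.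
  by apply: contraNN wU; apply/subsetP/outer_sub.
by move: H; move: #|coedges G| #|_| E10 Z7 => a b; lia.
Qed.

End StarCount.

(** * Coedges through the vertices on the axes *)

Section StarArcs.
Context {R : realFieldType} {n : nat} {G : 'M[R]_(3, n)}.
Context {u : 'I_n} {v : 'I_3 -> 'I_n}.
Hypotheses (gG : gale G) (stG : star G u v).
Hypothesis (U4 : (3 < #|@outers R n G|)%N).

Notation outer := (@outer R n G).
Notation outers := (@outers R n G).
Notation ucore := (@ucore n u v).

(* When [outer i] has only two elements, a point [y] that realizes the coedge
   [{v i, w}] vanishes at one of the two other coordinates; [j] is the remaining
   one. *)
Definition arc i j w :=
  [/\ w \in outer j, forall w', w' \in outer j -> w' != w -> G i w' <= G j w'
    & [set v i; w] \in coedges G].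

Lemma uniq3P (i j k : 'I_3) : uniq [:: i; j; k] -> [/\ i != j, i != k & j != k].
Proof. by rewrite /= !inE negb_or andbT => /andP[/andP[]]. Qed.

(** Let [y] realize the coedge: only its [i]-th coordinate is negative. If both others were
    positive, [y] would be negative on all of [outers] outside [outer i], so [outers] would be
    contained in [outer i] and [w], contradicting [U4]. If the [k]-th vanishes, nonnegativity at [u]
    makes the [j]-th at least as large as the [i]-th in absolute value, and nonnegativity at [w']
    then compares the coordinates of [w']. *)
Lemma arc_of_coedge i w : #|outer i| = 2%N -> w \notin ucore ->
  [set v i; w] \in coedges G -> exists2 j, j != i & arc i j w.
Proof.
move=> o2 wc vwE; have /coedgesP[_ [y ye]] := vwE.
have yi : y 0 i < 0 by rewrite -(starv stG) ye set21.
have yl l : l != i -> 0 <= y 0 l.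
  move=> li; rewrite leNgt -(starv stG) ye !inE (inj_eq (v_inj stG)) negb_or li
    /=.
  by apply: contraNneq wc => <-; apply: v_core.
have yu : 0 <= \sum_j y 0 j.
  rewrite leNgt -(staru stG) ye !inE negb_or eq_sym (v_neq_u stG) /=.
  by apply: contraNneq wc => <-; rewrite !inE eqxx.
have yw : \sum_j y 0 j * G j w < 0.
  by have := set22 (v i) w; rewrite -ye inE starE.
have yw' w' : w' \notin ucore -> w' != w -> 0 <= \sum_j y 0 j * G j w'.
  move=> w'c w'w; rewrite leNgt -starE; have := in_set2 w' (v i) w.
  rewrite -ye inE => ->; rewrite negb_or w'w andbT.
  by apply: contraNneq w'c => ->; apply: v_core.
suff H j k : uniq [:: i; j; k] -> y 0 k = 0 -> exists2 j, j != i & arc i j w.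
  have [j ji] : exists j : 'I_3, i != j.
    by have [->|i0] := eqVneq i 0; [exists 1|exists 0].
  have [k uijk] := ord3_third ji; have [ij ik jk] := uniq3P uijk.
  have uikj : uniq [:: i; k; j] by rewrite /= !inE negb_or ij ik eq_sym jk.
  have [yj|yj] := eqVneq (y 0 j) 0; first exact: H uikj yj.
  have [yk|yk] := eqVneq (y 0 k) 0; first exact: H uijk yk.
  have {}yj : 0 < y 0 j by rewrite lt0r yj yl // eq_sym.
  have {}yk : 0 < y 0 k by rewrite lt0r yk yl // eq_sym.
  move: U4; rewrite ltnNge => /negP[].
  apply: (@leq_trans #|w |: outer i|); last by rewrite cardsU1 o2;
    case: (_ \notin _).
  apply/subset_leq_card/subsetP => w'; rewrite (outersE uijk) -setUA in_setU1.
  rewrite in_setU; have [_|w'i] := boolP (w' \in outer i);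
    first by rewrite orbT.
  rewrite in_setU /= orbF => w'jk; apply/negPn/negP => w'w.
  have w'c : w' \notin ucore.
    by case/orP: w'jk => w'o; apply: (outer_noncore stG w'o).
  have := yw' _ w'c w'w; rewrite (sum_ord3 _ uijk).
  rewrite (noncore_eq0 stG w'c w'i) mulr0 add0r leNgt => /negP[].
  have Gj := noncore_le0 stG j w'c; have Gk := noncore_le0 stG k w'c.
  by case/orP: w'jk; rewrite outerE => Gw'; nra.
move=> uijk yk; have [ij ik jk] := uniq3P uijk.
move: yu yw; rewrite !(sum_ord3 _ uijk) yk mul0r !addr0 => yu yw.
have yj : 0 < y 0 j by lra.
have Giw w' : w' \notin ucore -> 0 <= y 0 i * G i w'.
  by move=> w'c; rewrite mulr_le0 ?(noncore_le0 stG) // ltW.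
exists j; first by rewrite eq_sym.
split=> // [|w' w'j w'w].
  by rewrite outerE -(pmulr_rlt0 _ yj); have := Giw _ wc; lra.
have w'c := outer_noncore stG w'j.
have := yw' _ w'c w'w; rewrite (sum_ord3 _ uijk) yk mul0r addr0 => H.
have := noncore_le0 stG i w'c; nra.
Qed.

Lemma coedge_v_cases i e : e \in coedges_at G (v i) ->
  [\/ e = [set v i; u], exists2 j, j != i & e = [set v i; v j]
    | exists2 w, w \notin ucore & e = [set v i; w]].
Proof.
move=> /coedge_pair[w wv ->]; have [wc|wc] := boolP (w \in ucore); last first.
  by apply: Or33; exists w.
move: wc; rewrite !inE => /orP[/eqP->|/imsetP[j _ wj]]; first exact: Or31.
apply: Or32; exists j; last by rewrite wj.
by apply: contraNneq wv => <-; rewrite wj.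
Qed.

(** The element [q] of [outer j] other than [w] satisfies [G i q <= G j q < 0], so it lies in
    [outer i] too; [w] does not, since the two sets differ. *)
Lemma arc_other i j w : #|outer i| = 2%N -> #|outer j| = 2%N ->
  outer i != outer j ->
  arc i j w -> exists q, outer i :&: outer j = [set q] /\ G i q <= G j q.
Proof.
move=> oi oj oij [wj Hw _].
have /cards1P[q qE] : #|outer j :\ w| == 1%N.
  by move: oj; rewrite (cardsD1 w) wj add1n => -[->].
have /[!in_setD1]/andP[qw qj] : q \in outer j :\ w by rewrite qE set11.
have qi : q \in outer i.
  by rewrite outerE (le_lt_trans (Hw q qj qw)) // -outerE.
exists q; split; last exact: Hw.
apply/esym/eqP; rewrite eqEcard sub1set inE qi qj cards1 /=.
suff /proper_card : outer i :&: outer j \proper outer j by rewrite oj ltnS.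
apply/properP; split; first exact: subsetIr.
exists w => //; rewrite inE wj andbT; apply: contraNN oij => wi.
rewrite eq_sym eqEcard oi oj leqnn andbT; apply/subsetP => t tj.
by have [->//|tw] := eqVneq t w; have := in_set1 t q;
  rewrite -qE in_setD1 tw tj => /esym/eqP->.
Qed.

(** Each element of [outer j] differs from [w] or from [w']; two distinct arcs would therefore put
    all of [outer j] into [outer i]. *)
Lemma arc_unique i j w w' : #|outer i| = 2%N -> #|outer j| = 2%N ->
  outer i != outer j -> arc i j w -> arc i j w' -> w = w'.
Proof.
move=> oi oj oij a a'; apply/eqP; apply: contraNT oij => ww'.
case: a => wj Hw _; case: a' => w'j Hw' _.
rewrite eq_sym eqEcard oi oj leqnn andbT; apply/subsetP => t tj; rewrite outerE.
have [tw|tw] := eqVneq t w; last by rewrite (le_lt_trans (Hw t tj tw)) //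
  -outerE.
by rewrite (le_lt_trans (Hw' t tj _)) -?outerE // tw.
Qed.

(** A realizing [y] is negative in coordinates [i] and [j], and nonnegativity at [u] makes the
    [k]-th coordinate at least the sum of their absolute values. Both claims are its nonnegativity
    at the elements of [outer k]. *)
Lemma coedge_vv i j k : uniq [:: i; j; k] -> [set v i; v j] \in coedges G ->
  outer k \subset outer i :|: outer j /\
  forall r, r \in outer k -> r \notin outer j -> G i r < G k r.
Proof.
move=> uijk; have [ij ik jk] := uniq3P uijk; case/coedgesP => _ [y ye].
have yi : y 0 i < 0 by rewrite -(starv stG) ye set21.
have yj : y 0 j < 0 by rewrite -(starv stG) ye set22.
have yu : 0 <= \sum_j y 0 j.
  by rewrite leNgt -(staru stG) ye !inE negb_or ![u == _]eq_sym !(v_neq_u stG).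
have yw w : w \notin ucore -> 0 <= \sum_j y 0 j * G j w.
  move=> wc; rewrite leNgt -starE; have := in_set2 w (v i) (v j).
  rewrite -ye inE => ->; rewrite negb_or.
  by apply/andP; split; apply: contraNneq wc => ->; apply: v_core.
move: yu; rewrite (sum_ord3 _ uijk) => yu.
split=> [|r rk rj].
  apply/subsetP => r rk; apply: contraT; rewrite inE negb_or => /andP[ri rj].
  have rc := outer_noncore stG rk.
  have := yw r rc; rewrite (sum_ord3 _ uijk) (noncore_eq0 stG rc ri)
    (noncore_eq0 stG rc rj).
  have yk : 0 < y 0 k by lra.
  by rewrite !mulr0 !add0r pmulr_rge0 // leNgt -outerE rk.
have rc := outer_noncore stG rk.
have := yw r rc; rewrite (sum_ord3 _ uijk) (noncore_eq0 stG rc rj) mulr0 addr0.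
by move: rk; rewrite outerE => rk H; nra.
Qed.

(** Of three coedges at [v i], at most one goes to [u] and none to another [v j]. *)
Lemma coedges_v_pair i :
    (forall j, j != i -> [set v i; v j] \notin coedges G) ->
    (2 < #|coedges_at G (v i)|)%N ->
  exists w w', [/\ w != w', w \notin ucore, w' \notin ucore,
    [set v i; w] \in coedges G & [set v i; w'] \in coedges G].
Proof.
move=> nvv E2.
have /card_gt1P[e [e' []]] : (1 < #|coedges_at G (v i) :\ [set v i; u]|)%N.
  by move: E2; rewrite (cardsD1 [set v i; u]); case: (_ \in coedges_at _ _);
    rewrite ?add1n ?add0n // => /ltnW.
have H f : f \in coedges_at G (v i) :\ [set v i; u] ->
    exists w, [/\ w \notin ucore, f = [set v i; w] & [set v i;
      w] \in coedges G].
  rewrite in_setD1 => /andP[fu fE].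
  have fG : f \in coedges G by move: fE; rewrite inE => /andP[].
  have [fe|[j ji fe]|[w wc fe]] := coedge_v_cases fE.
  - by rewrite fe eqxx in fu.
  - by have := nvv _ ji; rewrite -fe fG.
  - by exists w; split=> //; rewrite -fe.
move=> /H[w [wc -> wE]] /H[w' [wc' -> wE']] ww'.
by exists w, w'; split=> //; apply: contraNneq ww' => ->.
Qed.

Lemma coedges_v_one i :
    (forall j, j != i -> [set v i; v j] \notin coedges G) ->
    (1 < #|coedges_at G (v i)|)%N ->
  exists w, w \notin ucore /\ [set v i; w] \in coedges G.
Proof.
move=> nvv E2.
have /card_gt0P[f] : (0 < #|coedges_at G (v i) :\ [set v i; u]|)%N.
  by move: E2; rewrite (cardsD1 [set v i; u]); case: (_ \in coedges_at _ _);
    rewrite ?add1n ?add0n // => /ltnW.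
rewrite in_setD1 => /andP[fu fE].
have fG : f \in coedges G by move: fE; rewrite inE => /andP[].
have [fe|[j ji fe]|[w wc fe]] := coedge_v_cases fE.
- by rewrite fe eqxx in fu.
- by have := nvv _ ji; rewrite -fe fG.
- by exists w; rewrite -fe.
Qed.

End StarArcs.

(** * Eleven coedges force the extremal configuration *)

Section StarExtremal.
Context {R : realFieldType} {n : nat} {G : 'M[R]_(3, n)}.
Context {u : 'I_n} {v : 'I_3 -> 'I_n}.
Hypotheses (gG : gale G) (stG : star G u v).
Hypothesis E10 : (10 < #|coedges G|)%N.

Notation outer := (@outer R n G).
Notation outers := (@outers R n G).
Notation ucore := (@ucore n u v).
Notation arc := (@arc R n G v).
Notation Ev i := (coedges_at G (v i)).
Notation E0 := (@coedges_off_v R n G v).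

Let U4 : (3 < #|outers|)%N := card_outers gG stG E10.
Let Ev3 i : (#|Ev i| <= 3)%N := card_coedges_at (v i) gG.

Lemma uniq_ord3_perm (i j k : 'I_3) : uniq [:: i; j; k] ->
  uniq [:: i; k; j] /\ uniq [:: j; i; k].
Proof.
move=> /uniq3P[ij ik jk]; rewrite /= !inE !negb_or ij ik jk.
by rewrite [k == j]eq_sym [j == i]eq_sym ij jk.
Qed.

Lemma leq_card_setU3 (T : finType) (A B C : {set T}) :
  (#|A :|: B :|: C| <= #|A| + #|B| + #|C|)%N.
Proof.
apply: leq_trans (leq_of_leqif (leq_card_setU _ _)) _.
by rewrite leq_add2r (leq_of_leqif (leq_card_setU _ _)).
Qed.

Lemma coedges_cover i j k : uniq [:: i; j; k] ->
  (#|coedges G| <= #|E0| + #|Ev i :|: Ev j :|: Ev k|)%N.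
Proof.
move=> uijk; apply: leq_trans (leq_card_setU _ _).
apply/subset_leq_card/subsetP => e eE; rewrite in_setU.
have [//|/=] := boolP (e \in E0); rewrite inE eE /= negb_forall.
move=> /existsP[l]; rewrite negbK => vl.
have el : e \in Ev l by rewrite inE eE.
by rewrite !in_setU; case: (ord3P uijk l) => <-; rewrite el ?orbT.
Qed.

Lemma card_coedges_vv i j :
  [set v i; v j] \in coedges G -> (#|Ev i :|: Ev j| <= 5)%N.
Proof.
move=> vE; have : (0 < #|Ev i :&: Ev j|)%N.
  by apply/card_gt0P; exists [set v i; v j];
    rewrite in_setI ![_ \in Ev _]inE vE set21 set22.
have := cardsUI (Ev i) (Ev j); have := Ev3 i; have := Ev3 j.
by move: #|Ev i| #|Ev j| #|_ :|: _| #|_ :&: _| => a1 a2 a3 a4; clear; lia.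
Qed.

(** Two coedges from [v i] leave [ucore], both are arcs, and at most one of them is an arc towards
    [j]. *)
Lemma arc_third i j k : uniq [:: i; j; k] -> #|outer i| = 2%N ->
  #|outer j| = 2%N ->
    outer i != outer j -> (2 < #|Ev i|)%N ->
    (forall l, l != i -> [set v i; v l] \notin coedges G) ->
  exists w, arc i k w.
Proof.
move=> uijk oi oj oij E2 nvv.
have [w [w' [ww' wc wc' wE wE']]] := coedges_v_pair (u := u) nvv E2.
have [l li a] := arc_of_coedge stG U4 oi wc wE.
have [l' li' a'] := arc_of_coedge stG U4 oi wc' wE'.
case: (ord3P uijk l) li a => -> li a; [by rewrite eqxx in li| |by exists w].
case: (ord3P uijk l') li' a' => -> li' a';
  [by rewrite eqxx in li'| |by exists w'].
by rewrite (arc_unique oi oj oij a a') eqxx in ww'.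
Qed.

Lemma outer_off_v i : #|outer i| = 2%N -> outer i \in E0.
Proof.
move=> oi; rewrite inE outer_coedge //; apply/forallP => j.
by apply: contraT; rewrite negbK => /(outer_noncore stG); rewrite v_core.
Qed.

Lemma arc_outer_meet i k w : #|outer k| = 2%N -> arc i k w ->
  outer i :&: outer k != set0.
Proof.
move=> ok [wk Hw _].
have /card_gt0P[t] : (0 < #|outer k :\ w|)%N.
  by move: ok; rewrite (cardsD1 w) wk add1n => -[->].
rewrite in_setD1 => /andP[tw tk]; apply/set0Pn; exists t.
by rewrite inE tk andbT outerE (le_lt_trans (Hw t tk tw)) // -outerE.
Qed.

(** With two coedges off the [v i], the other nine or more meet the [v i], three at each and none
    shared. The resulting arcs from [i] and [j] to the third index [k] are incompatible with at
    least four elements in [outers]. *)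
Lemma coedges_off_v_neq2 : #|E0| != 2%N.
Proof.
apply/negP => E02; have /cards2P[a [b [ab E0ab]]] := E02.
have [i ai] : exists i, a = outer i by apply: (coedge_off_v gG stG);
  rewrite E0ab set21.
have [j bj] : exists j, b = outer j by apply: (coedge_off_v gG stG);
  rewrite E0ab set22.
have oij : outer i != outer j by rewrite -ai -bj.
have o2 e : e \in E0 -> #|e| = 2%N by rewrite inE => /andP[/coedgesP[]].
have oi : #|outer i| = 2%N by apply: o2; rewrite E0ab ai set21.
have oj : #|outer j| = 2%N by apply: o2; rewrite E0ab bj set22.
have [k uijk] : exists k, uniq [:: i; j; k].
  by apply: ord3_third; apply: contraNneq oij => ->.
have [uikj ujik] := uniq_ord3_perm uijk.
have [ij ik jk] := uniq3P uijk.
have cover i' j' k' : uniq [:: i'; j'; k'] ->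
  (8 < #|Ev i' :|: Ev j' :|: Ev k'|)%N.
  by move=> /coedges_cover/(leq_trans E10); rewrite (eqP E02).
have nvv i' j' : i' != j' -> [set v i'; v j'] \notin coedges G.
  move=> ij'; apply/negP => /card_coedges_vv.
  have [k' /cover] := ord3_third ij'; rewrite leqNgt => /negP H le5; apply: H.
  apply: leq_ltn_trans (leq_of_leqif (leq_card_setU _ _)) _.
  exact: leq_ltn_trans (leq_add le5 (Ev3 k')) _.
have E3 i' j' k' : uniq [:: i'; j'; k'] -> (2 < #|Ev i'|)%N.
  move=> /cover/leq_trans/(_ (leq_card_setU3 _ _ _)).
  have := Ev3 k'; have := Ev3 j'; move: #|Ev i'| #|Ev j'| #|Ev k'| => a1 a2 a3.
  by clear; lia.
have [w aik] : exists w, arc i k w.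
  by apply: (arc_third uijk) => // [|l li]; [apply: E3 uijk|apply: nvv;
    rewrite eq_sym].
have [w' ajk] : exists w, arc j k w.
  by apply: (arc_third ujik) => // [||l li];
    [rewrite eq_sym|apply: E3 ujik|apply: nvv; rewrite eq_sym].
(* If [outer k] were larger, each of the two arcs would put its [outer l] inside [outer k] and bound
   [outer k] by 3, so [outers = outer k] would be too small. *)
have ok3 : (#|outer k| <= 2)%N.
  rewrite leqNgt; apply/negP => ok.
  have sub l x : #|outer l| = 2%N -> arc l k x ->
    outer l \subset outer k /\ (#|outer k| <= 3)%N.
    move=> ol [xk Hx _].
    have kx : outer k :\ x \subset outer l.
      apply/subsetP => t; rewrite in_setD1 => /andP[tx tk].
      by rewrite outerE (le_lt_trans (Hx t tk tx)) // -outerE.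
    have := cardsD1 x (outer k); rewrite xk add1n => okx.
    have := subset_leq_card kx; rewrite ol => le2; split; last by rewrite okx.
    have /eqP <- : outer k :\ x == outer l by rewrite eqEcard kx ol -ltnS -okx.
    exact: subsetDl.
  have [ik' k3] := sub _ _ oi aik; have [jk' _] := sub _ _ oj ajk.
  move: U4; rewrite (outersE uijk) ltnNge (leq_trans _ k3) // subset_leq_card
    //.
  by rewrite !subUset ik' jk' subxx.
have ok : #|outer k| = 2%N by apply/eqP; rewrite eqn_leq ok3 card_outer.
(* Having two elements, [outer k] is a coedge in [E0] and equals [outer i] or [outer j]. Four
   elements in [outers] then make these two disjoint, whereas by the arcs both meet [outer k]. *)
have disj : outer k \in [set outer i; outer j] -> outer i :&: outer j = set0.
  move=> kij; apply/eqP; rewrite -cards_eq0 -leqn0.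
  have UE : outers = outer i :|: outer j.
    rewrite (outersE uijk); apply/setUidPl.
    by move: kij; rewrite !inE => /orP[]/eqP ->; rewrite ?subsetUl ?subsetUr.
  have := cardsUI (outer i) (outer j); rewrite -UE oi oj; move: U4.
  by move: #|outers| #|_ :&: _| => a1 a2; clear; lia.
have := outer_off_v ok; rewrite E0ab ai bj => kij.
have := arc_outer_meet ok aik; have := arc_outer_meet ok ajk.
move: (disj kij); move: kij; rewrite !inE => /orP[]/eqP -> d0.
  by rewrite setIC d0 eqxx.
by rewrite d0 eqxx.
Qed.

(** Up to zero columns and positive factors, the columns are then (1, 1, 1), the three basis vectors
    and the negatives of these four, with [q] opposite to [u]. *)
Definition star_extremal : Prop :=
  [/\ forall i, #|outer i| = 2%N, injective outer &
      exists q, (forall i, q \in outer i) /\ forall i j, G i q = G j q].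

Section Distinct.
Hypotheses (o2 : forall i, #|outer i| = 2%N) (oinj : injective outer).
Hypothesis Ev8 : forall i j k, uniq [:: i; j; k] ->
  (7 < #|Ev i :|: Ev j :|: Ev k|)%N.

Let oneq (i j : 'I_3) : i != j -> outer i != outer j.
Proof. by move=> ij; rewrite (inj_eq oinj). Qed.

(** By [coedge_vv] the union of [outer i] and [outer j] is all of [outers], which has at least four
    elements. *)
Lemma vv_disjoint i j k : uniq [:: i; j; k] -> [set v i; v j] \in coedges G ->
  outer i :&: outer j = set0.
Proof.
move=> uijk vE; have [kij _] := coedge_vv stG uijk vE.
apply/eqP; rewrite -cards_eq0 -leqn0.
move: U4; rewrite (outersE uijk) (setUidPl kij).
have := cardsUI (outer i) (outer j); rewrite !o2.
by move: #|_ :|: _| #|_ :&: _| => a1 a2; clear; lia.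
Qed.

Lemma vv_meet i j k : uniq [:: i; j; k] -> [set v i; v j] \in coedges G ->
  outer k :&: outer i != set0.
Proof.
move=> uijk vE; have [kij _] := coedge_vv stG uijk vE.
have [ij ik jk] := uniq3P uijk.
apply: contraNneq (oneq jk) => ki0; rewrite eq_sym eqEcard !o2 leqnn andbT.
apply/subsetP => t tk; have := subsetP kij t tk; rewrite in_setU => /orP[ti|//].
by have := in_set0 t; rewrite -ki0 inE tk ti.
Qed.

(** Such a coedge excludes [{v k, v i}] and [{v k, v j}], because [outer k] meets both other outer
    sets, and excludes arcs from [k], whose inequality contradicts the strict one of [coedge_vv]. So
    only [{v k, u}] can remain at [v k], and the coedges at the three [v]'s number at most 5 + 1,
    fewer than 8. *)
Lemma no_vv i j : i != j -> [set v i; v j] \notin coedges G.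
Proof.
move=> ij; apply/negP => vE; have [k uijk] := ord3_third ij.
have [uikj ujik] := uniq_ord3_perm uijk; have [_ ik jk] := uniq3P uijk.
have vE' : [set v j; v i] \in coedges G by rewrite setUC.
have dij := vv_disjoint uijk vE.
have not_vki x y : uniq [:: x; y; k] -> [set v x; v y] \in coedges G ->
    [set v k; v x] \notin coedges G.
  move=> uxyk vxy; apply: contraNN (vv_meet uxyk vxy); rewrite setUC => vxk.
  by have [uxky _] := uniq_ord3_perm uxyk; rewrite setIC (vv_disjoint uxky vxk).
have not_arc x y w : uniq [:: x; y; k] -> [set v x; v y] \in coedges G ->
    ~ arc k x w.
  move=> uxyk vxy a; have [xy xk yk] := uniq3P uxyk.
  have kx : outer k != outer x by rewrite eq_sym oneq.
  have [q [qE]] := arc_other (o2 k) (o2 x) kx a.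
  have : q \in outer k :&: outer x by rewrite qE set11.
  rewrite inE => /andP[qk qx]; rewrite leNgt.
  have [_ ->//] := coedge_vv stG uxyk vxy.
  apply/negP => qy; have := in_set0 q.
  by rewrite -(vv_disjoint uxyk vxy) inE qx qy.
have Ek : Ev k \subset [set [set v k; u]].
  apply/subsetP => e eE; have eG : e \in coedges G by move: eE;
    rewrite inE => /andP[].
  rewrite in_set1; have [->//|[l lk el]|[w wc ew]] := coedge_v_cases (u :=
    u) eE.
    case: (ord3P uijk l) lk el => -> lk el; last by rewrite eqxx in lk.
      by have := not_vki _ _ uijk vE; rewrite -el eG.
    by have := not_vki _ _ ujik vE'; rewrite -el eG.
  rewrite ew in eG; have [l lk a] := arc_of_coedge stG U4 (o2 k) wc eG.
  case: (ord3P uijk l) lk a => -> lk a; last by rewrite eqxx in lk.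
    by case: (not_arc _ _ _ uijk vE a).
  by case: (not_arc _ _ _ ujik vE' a).
have := subset_leq_card Ek; rewrite cards1 => Ek1.
have := Ev8 uijk; rewrite leqNgt => /negP; apply.
apply: leq_ltn_trans (leq_of_leqif (leq_card_setU _ _)) _.
exact: leq_ltn_trans (leq_add (card_coedges_vv vE) Ek1) _.
Qed.

(** Arcs in both directions between two indices make the coordinates equal at the common element of
    their outer sets: at [q] for [i] and [j], at [r] for [i] and [k]. If [q] and [r] differed,
    [outer k] would lie in the union of the other two outer sets, which has only three elements. *)
Lemma star_extremal_arcs i j k w1 w2 w3 w4 w5 : uniq [:: i; j; k] ->
    arc i j w1 -> arc i k w2 -> arc j i w3 -> arc j k w4 -> arc k i w5 ->
  star_extremal.
Proof.
move=> uijk aij aik aji ajk aki; have [ij ik jk] := uniq3P uijk.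
have [q [qE qij]] := arc_other (o2 i) (o2 j) (oneq ij) aij.
have ji : j != i by rewrite eq_sym.
have ki : k != i by rewrite eq_sym.
have [q' [qE' qji]] := arc_other (o2 j) (o2 i) (oneq ji) aji.
have qq' : q' = q by apply/set1P; rewrite -qE setIC qE' set11.
have [r [rE rik]] := arc_other (o2 i) (o2 k) (oneq ik) aik.
have [r' [rE' rki]] := arc_other (o2 k) (o2 i) (oneq ki) aki.
have rr' : r' = r by apply/set1P; rewrite -rE setIC rE' set11.
have [s [sE sjk]] := arc_other (o2 j) (o2 k) (oneq jk) ajk.
subst q' r'.
have /[!inE]/andP[qi qj] : q \in outer i :&: outer j by rewrite qE inE.
have /[!inE]/andP[ri rk] : r \in outer i :&: outer k by rewrite rE inE.
have /[!inE]/andP[sj sk] : s \in outer j :&: outer k by rewrite sE inE.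
have rq : r = q.
  apply/eqP; apply: contraT => rq; move: U4; rewrite ltnNge => /negP[].
  have rs : r != s.
    apply: contraNneq rq => rs; rewrite -in_set1 -qE !inE ri.
    by rewrite rs sj.
  have kE : outer k = [set r; s].
    apply/esym/eqP; rewrite eqEcard o2 cards2 rs andbT subUset !sub1set !inE.
    by rewrite rk sk.
  have -> : outers = outer i :|: outer j.
    rewrite (outersE uijk); apply/setUidPl; rewrite kE subUset !sub1set !inE.
    by rewrite ri sj orbT.
  have := cardsUI (outer i) (outer j).
  by rewrite !o2 qE cards1 addn1 => -[->].
subst r; split=> //; exists q.
have all3 (P : 'I_3 -> Prop) : P i -> P j -> P k -> forall l, P l.
  by move=> Pi Pj Pk l; case: (ord3P uijk l) => ->.
split; first by apply: (all3 (fun l => q \in outer l)); rewrite inE.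
have Gij : G i q = G j q by apply: le_anti; rewrite qij qji.
have Gik : G i q = G k q by apply: le_anti; rewrite rik rki.
have Gl : forall l, G l q = G i q by apply: all3.
by move=> l l'; rewrite !Gl.
Qed.

(** At least eight coedges, at most three at each [v i], leave the counts 3, 3 and at least 2. Two
    indices thus have arcs in both directions and the third has at least one arc, five in all. *)
Lemma star_extremal_distinct : star_extremal.
Proof.
have nvv i l : l != i -> [set v i; v l] \notin coedges G.
  by rewrite eq_sym; apply: no_vv.
suff H i j k : uniq [:: i; j; k] -> (2 < #|Ev i|)%N -> (2 < #|Ev j|)%N ->
    (1 < #|Ev k|)%N -> star_extremal.
  have u0 : uniq [:: 0; 1; ord_max : 'I_3] by [].
  have [u1 u2] := uniq_ord3_perm u0; have [u3 _] := uniq_ord3_perm u2.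
  have := leq_trans (Ev8 u0) (leq_card_setU3 _ _ _).
  have := Ev3 0; have := Ev3 1; have := Ev3 ord_max.
  have arith a b c : (c <= 3 -> b <= 3 -> a <= 3 -> 7 < a + b + c ->
    [\/ [/\ 2 < a, 2 < b & 1 < c], [/\ 2 < a, 2 < c & 1 < b]
      | [/\ 2 < b, 2 < c & 1 < a]])%N.
    clear; move=> c3 b3 a3 s8; have [a2|a2] := ltnP 2 a; last first.
      by apply: Or33; split; lia.
    have [b2|b2] := ltnP 2 b; last by apply: Or32; split; lia.
    by apply: Or31; split; lia.
  move=> e2 e1 e0 /(arith _ _ _ e2 e1 e0)[] [].
  - exact: H.
  - exact: H.
  - exact: (H 1 ord_max 0).
move=> uijk Ei Ej Ek; have [ij ik jk] := uniq3P uijk.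
have [uikj ujik] := uniq_ord3_perm uijk; have [ujki _] := uniq_ord3_perm ujik.
have [w2 aik] := arc_third uijk (o2 i) (o2 j) (oneq ij) Ei (nvv i).
have [w1 aij] := arc_third uikj (o2 i) (o2 k) (oneq ik) Ei (nvv i).
have ji : j != i by rewrite eq_sym.
have [w4 ajk] := arc_third ujik (o2 j) (o2 i) (oneq ji) Ej (nvv j).
have [w3 aji] := arc_third ujki (o2 j) (o2 k) (oneq jk) Ej (nvv j).
have [w [wc wE]] := coedges_v_one (u := u) (nvv k) Ek.
have [l lk a] := arc_of_coedge stG U4 (o2 k) wc wE.
case: (ord3P uijk l) lk a => -> lk a; last by rewrite eqxx in lk.
  exact: star_extremal_arcs uijk aij aik aji ajk a.
exact: star_extremal_arcs ujik aji ajk aij aik a.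
Qed.

End Distinct.

Theorem star_extremalP : star_extremal.
Proof.
have cover i j k : uniq [:: i; j; k] ->
    (10 < #|E0| + #|Ev i :|: Ev j :|: Ev k|)%N.
  by move=> /coedges_cover; apply: leq_trans.
have u0 : uniq [:: 0; 1; ord_max : 'I_3] by [].
have E03 := leq_trans (subset_leq_card (coedges_off_v_sub gG stG))
  (leq_imset_card _ _).
rewrite card_ord in E03.
(* At most nine coedges meet the [v i], so at least two avoid them; exactly two has been
   excluded. *)
have E0eq : #|E0| = 3%N.
  apply/eqP; rewrite eqn_leq E03 /= ltn_neqAle eq_sym coedges_off_v_neq2 /=.
  have := leq_trans (cover _ _ _ u0) (leq_add (leqnn _) (leq_card_setU3 _ _ _)).
  have := Ev3 0; have := Ev3 1; have := Ev3 ord_max.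
  move: #|Ev 0| #|Ev 1| #|Ev ord_max| #|E0| => a1 a2 a3 a4.
  by clear; lia.
have E0i : E0 = [set outer i | i : 'I_3].
  apply/eqP; rewrite eqEcard (coedges_off_v_sub gG stG) /= E0eq.
  by rewrite (leq_trans (leq_imset_card _ _)) // card_ord.
apply: star_extremal_distinct => [i||i j k /cover].
- have : outer i \in E0 by rewrite E0i imset_f.
  by rewrite inE => /andP[/coedgesP[]].
- have /imset_injP oinj : #|[set outer i | i : 'I_3]| == #|'I_3|.
    by rewrite -E0i E0eq card_ord.
  by move=> i j; apply: oinj.
- by rewrite E0eq.
Qed.

End StarExtremal.

(** * The extremal configuration *)

Section Prismatic.
Context {R : realFieldType}.

(* [D] is, up to zero coordinates and positive scaling, the space of affine
   dependencies of the prism over a tetrahedron; [l (i, false)] and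
   [l (i, true)] are the endpoints of the [i]-th edge between its two bases. *)
Definition prismatic n (D : 'rV[R]_n -> Prop) : Prop :=
  exists (l : 'I_4 * bool -> 'I_n) (c : 'I_4 * bool -> R),
    [/\ injective l, forall a, 0 < c a &
      forall x, D x <-> exists Y : 'I_4 -> R,
        [/\ \sum_i Y i = 0, forall a, x 0 (l a) = c a * ((-1) ^+ a.2 * Y a.1) &
            forall z, (forall a, l a != z) -> x 0 z = 0]].

Lemma star_prismatic n (G : 'M[R]_(3, n)) u v :
  star G u v -> @star_extremal R n G -> prismatic (fun x => exists y,
    x = y *m G).
Proof.
move=> stG [o2 oinj [q [qo Gq]]].
have /fin_all_exists[p pP] (i : 'I_3) : exists w, w != q /\ outer (G :=
  G) i = [set q; w].
  have := o2 i; rewrite (cardsD1 q) qo add1n => -[/eqP/cards1P[w ow]].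
  exists w; split; last by rewrite -(setD1K (qo i)) ow.
  by have := set11 w; rewrite -ow in_setD1 => /andP[].
have pq i : p i != q by case: (pP i).
have oE i : outer (G := G) i = [set q; p i] by case: (pP i).
have po i : p i \in outer (G := G) i by rewrite oE set22.
have qc : q \notin ucore (u := u) (v := v) by apply: (outer_noncore stG (qo 0)).
have pc i : p i \notin ucore (u := u) (v := v) by apply: (outer_noncore stG (po
  i)).
have uc : u \in ucore (u := u) (v := v) by rewrite !inE eqxx.
have vc i : v i \in ucore (u := u) (v := v) by apply: v_core.
have pinj : injective p by move=> i j pij; apply: oinj; rewrite !oE pij.
have Gp i j : i != j -> G i (p j) = 0.
  move=> ij; apply: (noncore_eq0 stG (pc j)); rewrite oE !inE (negPf (pq j)) /=.
  by rewrite (inj_eq pinj) eq_sym.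
have Gq0 i : G i q < 0 by rewrite -outerE.
have Gpp i : G i (p i) < 0 by rewrite -outerE.
(* The four edges between the bases are the opposite pairs [(q, u)] and [(v i, p i)]. The parameter
   [Y] consists of the coordinates of [y], preceded by minus their sum. *)
pose l (a : 'I_4 * bool) :=
  if unlift ord0 a.1 is Some i then if a.2 then p i else v i
  else if a.2 then u else q.
pose c (a : 'I_4 * bool) :=
  if unlift ord0 a.1 is Some i then if a.2 then - G i (p i) else G i (v i)
  else if a.2 then 1 else - G 0 q.
have sep x y : x \notin ucore (u := u) (v := v) -> y \in ucore (u :=
  u) (v := v) -> x != y.
  by move=> xc yc; apply: contraNneq xc => ->.
have linj : injective l.
  have vu := v_neq_u stG; have vinj := v_inj stG.
  move=> [a1 b1] [a2 b2]; rewrite /l /=.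
  case: (unliftP ord0 a1) => [i|] ->; case: (unliftP ord0 a2) => [j|] ->;
    case: b1; case: b2 => /eqP; rewrite ?eqxx ?(inj_eq vinj) ?(inj_eq pinj) //.
  - by move=> /eqP->.
  - by rewrite (negPf (sep _ _ (pc i) (vc j))).
  - by rewrite eq_sym (negPf (sep _ _ (pc j) (vc i))).
  - by move=> /eqP->.
  - by rewrite (negPf (sep _ _ (pc i) uc)).
  - by rewrite (negPf (pq i)).
  - by rewrite (negPf (vu i)).
  - by rewrite eq_sym (negPf (sep _ _ qc (vc i))).
  - by rewrite eq_sym (negPf (sep _ _ (pc j) uc)).
  - by rewrite eq_sym (negPf (vu j)).
  - by rewrite eq_sym (negPf (pq j)).
  - by rewrite (negPf (sep _ _ qc (vc j))).
  - by rewrite eq_sym (negPf (sep _ _ qc uc)).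
  - by rewrite (negPf (sep _ _ qc uc)).
have c0 a : 0 < c a.
  rewrite /c; case: (unlift _ _) => [i|]; case: a.2; rewrite ?oppr_gt0 //.
  exact: Gvv stG i.
have val (y : 'rV_3) (Y : 'I_4 -> R) : (forall i, Y (lift ord0 i) = y 0 i) ->
    \sum_i Y i = 0 ->
    (forall a, (y *m G) 0 (l a) = c a * ((-1) ^+ a.2 * Y a.1)) /\
    forall z, (forall a, l a != z) -> (y *m G) 0 z = 0.
  move=> Yy; rewrite big_ord_recl => /eqP; rewrite addr_eq0 => /eqP Y0.
  have {}Y0 : Y ord0 = - \sum_i y 0 i by rewrite Y0; congr (- _);
    apply: eq_bigr.
  split=> [[a b]|z zl].
    rewrite mxE /l /c /=; case: (unliftP ord0 a) => [i|] ->.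
      rewrite (bigD1 i) //= big1 => [|j ji]; last first.
        by case: b; rewrite ?Gp ?(Gvn stG) ?mulr0.
      by rewrite Yy addr0; case: b; rewrite ?expr0 ?expr1; ring.
    rewrite Y0; case: b => /=.
      rewrite expr1 mulN1r opprK mul1r; apply: eq_bigr => j _.
      by rewrite (Gu stG) mulr1.
    by rewrite expr0 mul1r mulrNN mulr_sumr; apply: eq_bigr => j _;
      rewrite (Gq j 0) mulrC.
  rewrite mxE big1 // => i _; rewrite (noncore_eq0 stG) ?mulr0 //.
    rewrite !inE negb_or; apply/andP; split.
      by have := zl (ord0, true); rewrite /l /= unlift_none eq_sym.
    apply/imsetP => -[j _ zv]; have := zl (lift ord0 j, false).
    by rewrite /l /= liftK zv eqxx.
  rewrite oE !inE negb_or; apply/andP; split.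
    by have := zl (ord0, false); rewrite /l /= unlift_none eq_sym.
  by have := zl (lift ord0 i, true); rewrite /l /= liftK eq_sym.
exists l, c; split=> // x; split=> [[y ->]|[Y [Y0 Yl Yz]]].
  pose Y (i : 'I_4) := if unlift ord0 i is Some j then y 0 j else - \sum_j y 0
    j.
  have Yy i : Y (lift ord0 i) = y 0 i by rewrite /Y liftK.
  have Y0 : \sum_i Y i = 0.
    by rewrite big_ord_recl (eq_bigr _ (fun i _ => Yy i)) /Y unlift_none addNr.
  by have [H1 H2] := val y Y Yy Y0; exists Y.
pose y : 'rV_3 := \row_i Y (lift ord0 i).
have [|H1 H2] := val y Y _ Y0; first by move=> i; rewrite mxE.
exists y; apply/rowP => z.
have [[a <-]|zl] := pselect (exists a, l a = z); first by rewrite Yl H1.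
have zl' a : l a != z by apply/eqP => az; apply: zl; exists a.
by rewrite Yz // H2.
Qed.

Theorem coedges_le10_or_prismatic n (K : 'M[R]_(3, n)) : gale K ->
  (#|coedges K| <= 10)%N \/ prismatic (fun x => exists y, x = y *m K).
Proof.
move=> gK; have [|E10] := leqP #|coedges K| 10; [by left|right].
have [u du] : exists u, #|coedges_at K u| = 3%N.
  apply: contrapT => d3; move: E10; rewrite ltnNge => /negP; apply.
  apply: (coedges_le10_deg2 gK) => u; have := card_coedges_at u gK.
  by rewrite leq_eqVlt => /orP[/eqP du|//]; case: d3; exists u.
have [A [v [uA stG]]] := star_of_degree3 gK du.
have [l [c [linj c0 lP]]] := star_prismatic stG
  (star_extremalP (gale_unit uA gK) stG (eq_ind_r (fun E : {set {set 'I_n}} =>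
    10 < #|E|)%N E10 (coedges_unit K uA))).
exists l, c; split=> // x; rewrite -lP; split=> -[y ->].
  by exists (y *m invmx A); rewrite mulmxA mulmxKV.
by exists (y *m A); rewrite mulmxA.
Qed.

Lemma card_neq_pairs : #|[set x : 'I_4 * 'I_4 | x.1 != x.2]| = 12%N.
Proof.
have := cardsC [set x : 'I_4 * 'I_4 | x.1 == x.2].
have -> : [set x : 'I_4 * 'I_4 | x.1 == x.2] = [set (i, i) | i : 'I_4].
  apply/setP => -[i j]; rewrite inE /=; apply/eqP/imsetP => [->|[k _ [->
    ->]//]].
  by exists j.
rewrite card_imset => [|i j []//]; rewrite card_prod !card_ord => H.
apply: (@addnI 4); rewrite -[RHS]H; congr (4 + #|(_ : {set _})|)%N.
apply/setP => -[i j]; rewrite in_set in_setC /=; congr (~~ _);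
  apply/eqP/imsetP => [->|[k _ [-> ->]//]].
by exists j.
Qed.

(** The coedges exhibited are the diagonals of the prism, from one base to a non-corresponding
    vertex of the other. Twelve of them rule out the value 11. *)
Lemma prismatic_coedges n k (K : 'M[R]_(k, n)) :
  prismatic (fun x => exists y, x = y *m K) -> (12 <= #|coedges K|)%N.
Proof.
move=> [l [c [linj c0 lP]]].
pose f (x : 'I_4 * 'I_4) := [set l (x.1, true); l (x.2, false)].
have finj : injective f.
  move=> [i j] [i' j'] /setP ff.
  have := ff (l (i, true)); have := ff (l (j, false)).
  rewrite /f !inE /= !(inj_eq linj) !eqxx !orbT /= !xpair_eqE !andbF orbF /=.
  by rewrite !andbT => /esym/eqP-> /esym/eqP->.
apply: (leq_trans (eq_leq (esym card_neq_pairs))).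
rewrite -(card_imset _ finj); apply/subset_leq_card.
apply/subsetP => e /imsetP[[i j]]; rewrite inE /= => ij ->.
apply/coedgesP; split; first by rewrite cards2 (inj_eq linj) xpair_eqE andbF.
(* This dependency is negative exactly at the top end of edge [i] and the bottom end of edge [j]. *)
pose Y (m : 'I_4) : R := (m == i)%:R - (m == j)%:R.
pose x : 'rV[R]_n := \row_z \sum_a (l a == z)%:R * (c a * ((-1) ^+ a.2 * Y
  a.1)).
have xl a : x 0 (l a) = c a * ((-1) ^+ a.2 * Y a.1).
  rewrite mxE (bigD1 a) //= eqxx mul1r big1 ?addr0 // => b ba.
  by rewrite (inj_eq linj) (negPf ba) mul0r.
have xz z : (forall a, l a != z) -> x 0 z = 0.
  by move=> zl; rewrite mxE big1 // => a _; rewrite (negPf (zl a)) mul0r.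
have [y xy] : exists y, x = y *m K.
  apply/lP; exists Y; split=> //.
  rewrite sumrB (bigD1 i) //= eqxx big1 => [|m /negPf->//].
  by rewrite (bigD1 j) //= eqxx big1 => [|m /negPf->//]; rewrite subrr.
exists y; rewrite -xy; apply/setP => z; rewrite inE.
have [[[m b] <-]|zl] := pselect (exists a, l a = z); last first.
  have zl' a : l a != z by apply/eqP => az; apply: zl; exists a.
  by rewrite xz // ltxx /f !inE /= ![z == _]eq_sym !(negPf (zl' _)).
rewrite xl pmulr_rlt0 // /f /= !inE !(inj_eq linj) !xpair_eqE /Y.
have [->|mi] := eqVneq m i; last have [_|_] := eqVneq m j.
- by rewrite (negPf ij) subr0; case: b; rewrite /= ?expr1 ?expr0 ?mulN1r ?mul1r
  ?opprK ?ltrN10 ?ltr10.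
- by rewrite sub0r; case: b; rewrite /= ?expr1 ?expr0 ?mulN1r ?mul1r ?opprK
  ?ltrN10 ?ltr10.
- by rewrite subrr mulr0 ltxx.
Qed.
End Prismatic.

From mathcomp Require Import finmap.
From mathcomp Require Import classical_sets functions cardinality reals.
From mathcomp Require Import interval_inference convex.

(** * Polytopes and their dependencies *)

Section Hulls.
Context {R : realType}.

Definition hull m n (p : 'I_n -> 'rV[R]_m) (J : {set 'I_n}) : set 'rV[R]_m :=
  convex_hull (p @` [set` J])%classic.

Lemma convex_comb m (C : set 'rV[R]_m) (x y : 'rV[R]_m) (t : R) :
  @convex_set R 'rV[R]_m C -> C x -> C y -> 0 <= t -> t <= 1 ->
  C (t *: x + (1 - t) *: y).
Proof.
move=> cC Cx Cy t0 t1.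
have := cC x y (Itv01 t0 t1); rewrite !inE => /(_ Cx Cy).
by [].
Qed.

Lemma convex_sum m n (C : set 'rV[R]_m) (p : 'I_n -> 'rV[R]_m) (J : {set 'I_n})
    (w : 'I_n -> R) :
  @convex_set R 'rV[R]_m C -> (forall i, i \in J -> C (p i)) ->
  (forall i, 0 <= w i) -> \sum_(i in J) w i = 1 -> C (\sum_(i in J) w i *: p i).
Proof.
move=> cC; move: {2}_.+1 (ltnSn #|J|) => N;
  elim: N J w => // N IHN J w JN pJ w0 w1.
have [J0|[i iJ]] := set_0Vmem J.
  by move: w1; rewrite J0 big_set0 => /eqP; rewrite eq_sym oner_eq0.
rewrite (big_setD1 i) //=; move: w1; rewrite (big_setD1 i) //= => w1.
have S0 : 0 <= \sum_(j in J :\ i) w j by apply: sumr_ge0.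
have [S00|Sneq0] := eqVneq (\sum_(j in J :\ i) w j) 0.
  rewrite big1 ?addr0 => [|j jJ].
    by move: w1; rewrite S00 addr0 => ->; rewrite scale1r; apply: pJ.
  have /eqP := S00; rewrite psumr_eq0 // => /allP/(_ j (mem_index_enum _)).
  by rewrite jJ => /eqP->; rewrite scale0r.
pose s := \sum_(j in J :\ i) w j; have s0 : 0 < s by rewrite lt0r Sneq0.
have wi : w i = 1 - s by rewrite -w1 addrK.
have -> : \sum_(j in J :\ i) w j *: p j =
    (1 - w i) *: \sum_(j in J :\ i) (w j / s) *: p j.
  rewrite wi subKr scaler_sumr; apply: eq_bigr => j _.
  by rewrite scalerA mulrCA divff ?mulr1 // gt_eqF.
apply: convex_comb => //.
- by apply: pJ.
- apply: (IHN (J :\ i) (fun j => w j / s)).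
  + by move: JN; rewrite (cardsD1 i) iJ.
  + by move=> j; rewrite in_setD1 => /andP[_ /pJ].
  + by move=> j; rewrite divr_ge0 // ltW.
  + by rewrite -mulr_suml divff // gt_eqF.
- by rewrite wi; move: s0; lra.
Qed.

Lemma hullP m n (p : 'I_n -> 'rV[R]_m) (J : {set 'I_n}) x :
  hull p J x <-> exists w : 'I_n -> R,
    [/\ forall i, 0 <= w i, forall i, i \notin J -> w i = 0,
        \sum_i w i = 1 & x = \sum_i w i *: p i].
Proof.
split=> [|[w [w0 wJ w1 ->]] C [cC pC]]; last first.
  have rest (V : nmodType) (F : 'I_n -> V) : (forall i, i \notin J ->
    F i = 0) ->
      \sum_i F i = \sum_(i in J) F i.
    by move=> F0; rewrite (bigID (mem J)) /= [X in _ + X]big1 ?addr0.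
  rewrite rest => [|i iJ]; last by rewrite wJ ?scale0r.
  apply: convex_sum => //; first by move=> i iJ; apply: pC; exists i.
  by rewrite -rest // => i; apply: wJ.
pose C := [set x : 'rV[R]_m | exists w : 'I_n -> R,
    [/\ forall i, 0 <= w i, forall i, i \notin J -> w i = 0,
        \sum_i w i = 1 & x = \sum_i w i *: p i]]%classic.
move=> /(_ C); apply; split=> [y z t|y [i /= iJ <-]].
  rewrite !inE => -[a [a0 aJ a1 ->]] [b [b0 bJ b1 ->]].
  have t0 : 0 <= t%:num by []. have t1 : t%:num <= 1 by [].
  exists (fun i => t%:num * a i + (1 - t%:num) * b i); split=> [i|i iJ||].
  - by rewrite addr_ge0 // mulr_ge0 // subr_ge0.
  - by rewrite aJ // bJ // !mulr0 addr0.
  - by rewrite big_split /= -!mulr_sumr a1 b1; lra.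
  - rewrite /conv /= !scaler_sumr -big_split; apply: eq_bigr => i _ /=.
    by rewrite [RHS]scalerDl !scalerA.
exists (fun j => (i == j)%:R); split=> [j|j jJ||].
- by [].
- by rewrite (_ : i == j = false) //; apply/eqP => ij; rewrite -ij iJ in jJ.
- by rewrite (bigD1 i) //= eqxx big1 ?addr0 // => j /negPf;
  rewrite eq_sym => ->.
- rewrite (bigD1 i) //= eqxx scale1r big1 ?addr0 // => j /negPf.
  by rewrite eq_sym => ->; rewrite scale0r.
Qed.

Lemma convex_hull_convex m (A : set 'rV[R]_m) :
  @convex_set R 'rV[R]_m (convex_hull A).
Proof.
move=> x y t; rewrite !inE => Hx Hy C CA.
have := CA => -[cC _]; have := cC x y t; rewrite !inE; apply.
  exact: Hx.
exact: Hy.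
Qed.

Lemma mem_hull m n (p : 'I_n -> 'rV[R]_m) (J : {set 'I_n}) i :
  i \in J -> hull p J (p i).
Proof. by move=> iJ C [_]; apply; exists i. Qed.

Lemma hull_sub m n (p : 'I_n -> 'rV[R]_m) (J : {set 'I_n}) (C : set 'rV[R]_m) :
  @convex_set R 'rV[R]_m C -> (forall i, i \in J -> C (p i)) ->
    (hull p J `<=` C)%classic.
Proof. by move=> cC pC x; apply; split=> // _ [i iJ <-]; apply: pC. Qed.

Lemma hullT m n (p : 'I_n -> 'rV[R]_m) : convex_hull (range p) = hull p [set:
  'I_n].
Proof.
rewrite /hull; congr convex_hull; apply/seteqP.
by split=> x [i _ <-]; exists i => //=; rewrite ?inE.
Qed.

(** Equivalently, [p] lists the vertices of its hull without repetition. *)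
Definition irredundant m n (p : 'I_n -> 'rV[R]_m) : Prop :=
  forall i, ~ hull p [set~ i] (p i).

(** A generating family with the least number of points is irredundant, since a redundant point
    could be dropped. *)
Lemma polytope_irredundant m (P : set 'rV[R]_m) : polytope P ->
  exists n (p : 'I_n -> 'rV[R]_m), irredundant p /\ P = hull p [set: 'I_n].
Proof.
move=> [V /finite_seqP[s Vs] PV].
have ex : exists n, `[< exists p : 'I_n -> 'rV[R]_m, P = hull p [set: 'I_n] >].
  exists (size s); apply/asboolP; exists (tnth (in_tuple s)).
  rewrite PV -hullT; congr convex_hull; rewrite Vs; apply/seteqP; split=> x /=.
    by move=> /(tnthP (in_tuple s))[i ->]; exists i.
  by move=> [i _ <-]; apply: mem_tnth.
have [n /asboolP[p Pp] nmin] := ex_minnP ex.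
exists n, p; split=> // i pi.
case: n p Pp nmin i pi => [p _ _ []//|n p Pp nmin i pi].
suff /asboolP/nmin : exists q : 'I_n -> 'rV[R]_m,
  P = hull q [set: 'I_n] by rewrite ltnn.
exists (p \o lift i); rewrite Pp; apply/seteqP; split; last first.
  by apply: hull_sub (@convex_hull_convex _ _) _ => j _; apply: mem_hull;
    rewrite inE.
have sub : (hull p [set~ i] `<=` hull (p \o lift i) [set: 'I_n])%classic.
  apply: hull_sub (@convex_hull_convex _ _) _ => j; rewrite !inE => ji.
  have [k ->|ij] := unliftP i j; last by rewrite ij eqxx in ji.
  by apply: (@mem_hull _ _ (p \o lift i)); rewrite inE.
apply: hull_sub (@convex_hull_convex _ _) _ => j _.
have [->|ji] := eqVneq j i; first exact: sub.
by apply: sub; apply: mem_hull; rewrite in_setC1.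
Qed.

End Hulls.

(** * Faces as sets of vertices *)

Section Faces.
Context {R : realType}.

(* The left kernel of [homog p] is the space of affine dependencies of [p], and
   its column space consists of the restrictions to [p] of affine functions. *)
Definition homog m n (p : 'I_n -> 'rV[R]_m) : 'M[R]_(n, 1 + m) :=
  \matrix_(i < n) row_mx (const_mx 1 : 'rV_1) (p i).

Lemma mul_homog m n (p : 'I_n -> 'rV[R]_m) (x : 'rV[R]_n) :
  x *m homog p = row_mx (const_mx (\sum_i x 0 i) : 'rV_1) (\sum_i x 0 i *: p i).
Proof.
apply/rowP => j; rewrite !mxE; case: splitP => k jk.
  rewrite mxE; apply: eq_bigr => i _.
  have -> : j = lshift m k by apply: val_inj.
  by rewrite mxE row_mxEl mxE mulr1.
rewrite summxE; apply: eq_bigr => i _.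
have -> : j = rshift 1 k by apply: val_inj.
by rewrite mxE row_mxEr mxE.
Qed.

Lemma mul_homog_eq0 m n (p : 'I_n -> 'rV[R]_m) (x : 'rV[R]_n) :
  x *m homog p = 0 <-> \sum_i x 0 i = 0 /\ \sum_i x 0 i *: p i = 0.
Proof.
rewrite mul_homog; have <- : row_mx (0 : 'rV[R]_1) (0 : 'rV[R]_m) = 0 by
  rewrite row_mx0.
split=> [/eq_row_mx[/rowP/(_ 0)]|[-> ->]].
  by rewrite !mxE.
by congr row_mx; apply/rowP => i; rewrite !mxE.
Qed.

Lemma homog_mulE m n (p : 'I_n -> 'rV[R]_m) (c : 'cV[R]_(1 + m)) i :
  (homog p *m c) i 0 = usubmx c 0 0 + (p i *m dsubmx c) 0 0.
Proof.
have -> : (homog p *m c) i 0 = (row i (homog p *m c)) 0 0 by rewrite [RHS]mxE.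
rewrite row_mul rowK -[c in LHS]vsubmxK mul_row_col mxE; congr (_ + _).
by rewrite mxE big_ord1 mxE mul1r.
Qed.

(** The coordinates of a dependency sum to 0, so without negative ones it is zero. With a single
    negative one, at [i], dividing by its absolute value writes [p i] as a convex combination of the
    other points. *)
Lemma irredundant_gale m n (p : 'I_n -> 'rV[R]_m) (x : 'rV[R]_n) :
  irredundant p -> x *m homog p = 0 -> x != 0 -> (1 < #|negset x|)%N.
Proof.
move=> irp /mul_homog_eq0[x1 xp] x0; rewrite ltnNge leq_eqVlt ltnS leqn0
  cards_eq0.
apply/negP => /orP[/cards1P[i xi]|/eqP xneg]; last first.
  case/eqP: x0; apply/rowP => i; rewrite mxE.
  have xge j : 0 <= x 0 j.
    by have := finset.in_set0 j; rewrite -xneg inE => /negbT; rewrite -leNgt.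
  have /eqP := x1; rewrite psumr_eq0 // => /allP/(_ i (mem_index_enum _))/eqP.
  exact.
have xi0 : x 0 i < 0 by have := set11 i; rewrite -xi inE.
have xge j : j != i -> 0 <= x 0 j.
  by move=> ji; have := finset.in_set1 j i;
    rewrite -xi inE (negPf ji) => /negbT; rewrite -leNgt.
apply: (irp i); apply/hullP.
pose s := - x 0 i; have s0 : 0 < s by rewrite oppr_gt0.
exists (fun j => if j == i then 0 else x 0 j / s); split=> [j|j||].
- by case: eqP => // /eqP/xge xj; rewrite divr_ge0 // ltW.
- by rewrite in_setC1 negbK => ->.
- move: x1; rewrite (bigD1 i) //= => /eqP; rewrite addr_eq0 => /eqP x1.
  rewrite (bigD1 i) //= eqxx add0r (eq_bigr (fun j => x 0 j / s)) => [|j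
    /negPf->//].
  rewrite -mulr_suml (_ : \sum_(j < n | j != i) x 0 j = s) ?divff ?gt_eqF //.
  by rewrite /s x1 opprK.
- move: xp; rewrite (bigD1 i) //= => /eqP; rewrite addr_eq0 => /eqP xp.
  rewrite (bigD1 i) //= eqxx scale0r add0r.
  rewrite (eq_bigr (fun j => s^-1 *: (x 0 j *: p j))) => [|j /negPf->];
    last first.
    by rewrite scalerA mulrC.
  rewrite -scaler_sumr; apply: (scalerI (negbT (gt_eqF s0))).
  by rewrite scalerA divff ?gt_eqF // scale1r /s scaleNr xp opprK.
Qed.

(** The column [c] is an affine function in homogeneous coordinates, so [homog p *m c] is the slack
    vector of a valid inequality and [J] the set of points where it is tight. *)
Definition slack_face m n (p : 'I_n -> 'rV[R]_m) (J : {set 'I_n}) : Prop :=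
  exists c : 'cV[R]_(1 + m), forall i,
    0 <= (homog p *m c) i 0 /\ (((homog p *m c) i 0 == 0) = (i \in J)).

(** The sign turns the slack into [b] minus a linear form, matching the inequality [c x <= b] of
    [faces]. *)
Definition slack_form m (c : 'cV[R]_(1 + m)) (x : 'rV[R]_m) : R :=
  (x *m - dsubmx c) 0 0.

Fact slack_form_is_linear m (c : 'cV[R]_(1 + m)) : scalar (slack_form c).
Proof. by move=> a x y; rewrite /slack_form mulmxDl -scalemxAl !mxE. Qed.

HB.instance Definition _ m (c : 'cV[R]_(1 + m)) :=
  GRing.isLinear.Build R 'rV[R]_m R *%R (slack_form c) (slack_form_is_linear c).

Lemma facesP m n (p : 'I_n -> 'rV[R]_m) (F : set 'rV[R]_m) :
  faces (hull p [set: 'I_n]) F <-> exists J, slack_face p J /\ F = hull p J.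
Proof.
have level (c : {scalar 'rV[R]_m}) (b : R) (J : {set 'I_n}) :
    (forall i, c (p i) <= b) -> (forall i, (c (p i) == b) = (i \in J)) ->
    [set x | hull p [set: 'I_n] x /\ c x = b]%classic = hull p J.
  move=> cb cJ.
  have cw (w : 'I_n -> R) : \sum_i w i = 1 ->
      b - c (\sum_i w i *: p i) = \sum_i w i * (b - c (p i)).
    move=> w1; rewrite linear_sum /= -{1}[b]mul1r -w1 mulr_suml -sumrB.
    by apply: eq_bigr => i _; rewrite linearZ mulrBr.
  apply/seteqP; split=> [x [/hullP[w [w0 _ w1 xw]] xb]|x /hullP[w [w0 wJ w1
    xw]]].
    apply/hullP; exists w; split=> // i iJ.
    have := cw _ w1; rewrite -xw xb subrr => /esym/eqP.
    rewrite psumr_eq0 => [/allP/(_ i (mem_index_enum _))|j _]; last first.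
      by rewrite mulr_ge0 // subr_ge0.
    by rewrite mulf_eq0 subr_eq0 eq_sym [b == _]eq_sym cJ (negPf iJ) orbF
      eq_sym => /eqP.
  split; first by apply/hullP; exists w; split=> // i; rewrite finset.inE.
  have := cw _ w1; rewrite -xw big1 => [/eqP|i _];
    first by rewrite subr_eq0 => /eqP.
  have [|/wJ->] := boolP (i \in J); last by rewrite mul0r.
  by rewrite -cJ => /eqP->; rewrite subrr mulr0.
split=> [[c [b [cb ->]]]|[J [[c cJ] ->]]].
  pose J := [set i | c (p i) == b]%SET.
  have cp i : c (p i) <= b by apply: cb; apply: mem_hull;
    rewrite finset.in_setT.
  exists J; split; last by apply: level => // i; rewrite finset.inE.
  pose a : 'cV[R]_m := \col_j - c (delta_mx 0 j).
  have ca x : (x *m a) 0 0 = - c x.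
    rewrite [x in RHS]row_sum_delta linear_sum -sumrN mxE;
      apply: eq_bigr => j _.
    by rewrite !mxE linearZ /= mulrN.
  exists (col_mx (const_mx b) a) => i.
  rewrite homog_mulE col_mxKu col_mxKd mxE ca subr_ge0 cp; split=> //.
  by rewrite subr_eq0 finset.inE eq_sym.
pose b := usubmx c 0 0.
have cE x : slack_form c x = - (x *m dsubmx c) 0 0 by rewrite /slack_form
  mulmxN mxE.
have sE i : (homog p *m c) i 0 = b - slack_form c (p i) by rewrite homog_mulE
  cE opprK.
have cp i : slack_form c (p i) <= b by rewrite -subr_ge0 -sE; case: (cJ i).
exists (slack_form c : {scalar 'rV[R]_m}), b; split; last first.
  apply/esym/level => // i.
  by case: (cJ i) => _ <-; rewrite sE subr_eq0 eq_sym.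
move=> x /hullP[w [w0 _ w1 ->]]; rewrite linear_sum /=.
have -> : b = \sum_i w i * b by rewrite -mulr_suml w1 mul1r.
by apply: ler_sum => i _; rewrite linearZ /= ler_wpM2l.
Qed.

(** A dependency is orthogonal to the slack vector, and here every term of their product is
    nonnegative. *)
Lemma slack_face_dep m n (p : 'I_n -> 'rV[R]_m) (J : {set 'I_n}) (x : 'rV[R]_n)
  :
  slack_face p J -> x *m homog p = 0 -> (forall i, i \notin J -> 0 <= x 0 i) ->
  forall i, i \notin J -> x 0 i = 0.
Proof.
move=> [c cJ] xp xJ i iJ.
have /eqP : \sum_j x 0 j * (homog p *m c) j 0 = 0.
  by have := mulmxA x (homog p) c; rewrite xp mul0mx => /rowP/(_ 0);
    rewrite !mxE.
rewrite psumr_eq0 => [/allP/(_ i (mem_index_enum _))|j _].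
  by case: (cJ i) => _ ci; rewrite mulf_eq0 ci (negPf iJ) orbF => /eqP.
have [cj0 cj] := cJ j; have [jJ|jJ] := boolP (j \in J);
  last by rewrite mulr_ge0 ?xJ.
by move: cj; rewrite jJ => /eqP->; rewrite mulr0.
Qed.

(** The converse of [slack_face_dep], by Farkas. It suffices to find, for each [k] outside [J], a
    valid inequality tight on [J] and strict at [k], and to add these up. *)
Lemma dep_slack_face m n (p : 'I_n -> 'rV[R]_m) (J : {set 'I_n}) :
  (forall x : 'rV[R]_n, x *m homog p = 0 -> (forall i, i \notin J ->
    0 <= x 0 i) ->
     forall i, i \notin J -> x 0 i = 0) ->
  slack_face p J.
Proof.
move=> H.
suff /fin_all_exists[c cP] (k : 'I_n) : exists c : 'cV[R]_(1 + m),
    [/\ forall i, 0 <= (homog p *m c) i 0, forall i, i \in J ->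
      (homog p *m c) i 0 = 0 &
        k \notin J -> 0 < (homog p *m c) k 0].
  have cs i : (homog p *m (\sum_k c k)) i 0 = \sum_k (homog p *m c k) i 0.
    by rewrite mulmx_sumr summxE.
  exists (\sum_k c k) => i; rewrite cs.
  have ge0 k : 0 <= (homog p *m c k) i 0 by case: (cP k).
  split; first exact: sumr_ge0.
  have [iJ|iJ] := boolP (i \in J).
    by rewrite big1 ?eqxx // => k _; case: (cP k) => _ ck _; apply: ck.
  rewrite psumr_eq0 //; apply/negP => /allP/(_ i (mem_index_enum _))/=.
  by case: (cP i) => _ _ /(_ iJ); rewrite lt0r => /andP[/negPf->].
have [kJ|kJ] := boolP (k \in J).
  by exists 0; rewrite mulmx0; split=> // i; rewrite mxE.
apply: contrapT => nc.
(* Tightness on [J] is encoded as two opposite inequalities: [T] keeps the negated copy of a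
   constraint only for indices in [J]. *)
pose A := row_mx (homog p)^T (- (homog p)^T).
pose T := [set a : 'I_(n + n) | if fintype.split a is inr j then j \in J else
  true]%SET.
have trE (y : 'rV_(1 + m)) i : (y *m (homog p)^T) 0 i = (homog p *m y^T) i 0.
  by rewrite -[homog p in RHS]trmxK -trmx_mul [RHS]mxE.
have [|a [a0 aT ab]] := @farkas R _ _ A T (- col k (homog p)^T).
  move=> y yT; rewrite mulmxN mxE oppr_ge0 mulmx_colE leNgt; apply/negP => yk.
  have y1 i : 0 <= (homog p *m y^T) i 0.
    have := yT (lshift n i); rewrite finset.inE (unsplitK (inl i)) => /(_ isT).
    by rewrite mul_mx_row row_mxEl trE.
  apply: nc; exists y^T; split=> [//|i iJ|_]; last by rewrite -trE.
  have := yT (rshift n i); rewrite finset.inE (unsplitK (inr i)) => /(_ iJ).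
  rewrite mul_mx_row row_mxEr mulmxN mxE oppr_ge0 trE => y2.
  by apply: le_anti; rewrite y1 y2.
pose x : 'rV[R]_n := (usubmx a - dsubmx a)^T + delta_mx 0 k.
have xE i : x 0 i = a (lshift n i) 0 - a (rshift n i) 0 + (i == k)%:R.
  by rewrite !mxE eqxx.
have xp : x *m homog p = 0.
  apply: trmx_inj; rewrite trmx_mul trmx0 linearD /= trmxK mulmxDr mulmxBr.
  move: ab; rewrite -{1}[a]vsubmxK mul_row_col mulNmx => ->.
  by rewrite trmx_delta -colE addNr.
have aJ i : i \notin J -> a (rshift n i) 0 = 0.
  by move=> iJ; apply: aT; rewrite finset.inE (unsplitK (inr i)).
have xk := H x xp _ k kJ; have : x 0 k = 0.
  apply: xk => i iJ; rewrite xE aJ // subr0 addr_ge0 //.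
by rewrite xE aJ // subr0 eqxx => /eqP; rewrite gt_eqF // ltr_wpDl.
Qed.

Lemma slack_face_mem m n (p : 'I_n -> 'rV[R]_m) (J : {set 'I_n}) i :
  slack_face p J -> hull p J (p i) -> i \in J.
Proof.
move=> [c cJ] /hullP[w [_ wJ w1 piw]]; case: (cJ i) => _ <-.
have -> : (homog p *m c) i 0 = \sum_j w j * (homog p *m c) j 0.
  have : row i (homog p) = (\row_j w j) *m homog p.
    rewrite rowK mul_homog piw; congr row_mx.
      apply/rowP => j; rewrite !mxE -[LHS]w1.
      by apply: eq_bigr => l _; rewrite mxE.
    by apply: eq_bigr => l _; rewrite mxE.
  move=> /(congr1 (mulmx^~ c)); rewrite -row_mul -mulmxA => /rowP/(_ 0).
  by rewrite mxE => ->; rewrite mxE; apply: eq_bigr => j _; rewrite mxE.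
apply/eqP/big1 => j _; have [jJ|jJ] := boolP (j \in J);
  last by rewrite wJ ?mul0r.
by case: (cJ j) => _; rewrite jJ => /eqP->; rewrite mulr0.
Qed.

Lemma slack_face_hull_sub m n (p : 'I_n -> 'rV[R]_m) (J J' : {set 'I_n}) :
  slack_face p J' -> (hull p J `<=` hull p J')%classic <-> J \subset J'.
Proof.
move=> fJ'; split=> [JJ|/fintype.subsetP JJ].
  by apply/fintype.subsetP => i iJ; apply: (slack_face_mem fJ'); apply: JJ;
    apply: mem_hull.
by apply: (hull_sub (@convex_hull_convex _ _ _)) => i /JJ; apply: mem_hull.
Qed.

Lemma slack_face_hull_inj m n (p : 'I_n -> 'rV[R]_m) (J J' : {set 'I_n}) :
  slack_face p J -> slack_face p J' -> hull p J = hull p J' -> J = J'.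
Proof.
move=> fJ fJ' JJ; apply/eqP; rewrite finset.eqEsubset.
by rewrite (slack_face_hull_sub _ fJ').1 ?JJ ?(slack_face_hull_sub _ fJ).1 ?JJ.
Qed.

End Faces.

(** * Dimension as a rank *)

Section Dimension.
Context {R : realType}.

Notation lift1 x := (row_mx (const_mx 1 : 'rV_1) x).

Lemma lift1_sub_homog m k (q : 'I_k -> 'rV[R]_m) (x : 'rV[R]_m) :
  (lift1 x <= homog q)%MS <->
  exists w : 'I_k -> R, \sum_i w i = 1 /\ x = \sum_i w i *: q i.
Proof.
split=> [/submxP[w]|[w [w1 ->]]].
  rewrite mul_homog => /eq_row_mx[/rowP/(_ 0) w1 ->]; exists (fun i => w 0 i).
  by rewrite !mxE in w1.
apply/submxP; exists (\row_i w i); rewrite mul_homog; congr row_mx.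
  by apply/rowP => i; rewrite !mxE -[LHS]w1; apply: eq_bigr => j _; rewrite mxE.
by apply: eq_bigr => j _; rewrite mxE.
Qed.

Lemma affine_hull_hullP m k (q : 'I_k -> 'rV[R]_m) (J : {set 'I_k}) (x :
  'rV[R]_m) :
  affine_hull (hull q J) x <->
  exists w : 'I_k -> R, [/\ forall i, i \notin J -> w i = 0, \sum_i w i = 1
    & x = \sum_i w i *: q i].
Proof.
split=> [[l [z [w [zJ w1 ->]]]]|[w [wJ w1 ->]]].
  have /fin_all_exists[a aP] i := (hullP q J (z i)).1 (zJ i).
  exists (fun j => \sum_i w i * a i j); split=> [j jJ||].
  - by rewrite big1 // => i _; case: (aP i) => _ /(_ j jJ) -> _ _;
    rewrite mulr0.
  - rewrite exchange_big /= -[RHS]w1; apply: eq_bigr => i _.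
    by rewrite -mulr_sumr; case: (aP i) => _ _ -> _; rewrite mulr1.
  - under [RHS]eq_bigr do rewrite scaler_suml.
    rewrite exchange_big /=; apply: eq_bigr => i _.
    case: (aP i) => _ _ _ {1}->; rewrite scaler_sumr; apply: eq_bigr => j _.
    by rewrite scalerA.
have rest (V : nmodType) (F : 'I_k -> V) : (forall i, i \notin J -> F i = 0) ->
    \sum_i F i = \sum_(i < #|J|) F (enum_val i).
  move=> F0; rewrite (bigID (mem J)) /= [X in _ + X]big1 ?addr0 //.
  by rewrite big_enum_val.
exists #|J|, (fun i => q (enum_val i)), (fun i => w (enum_val i)); split.
- by move=> i; apply: mem_hull; apply: enum_valP.
- by rewrite -rest.
- by rewrite rest // => i /wJ ->; rewrite scale0r.
Qed.

(** In homogeneous coordinates the affine space [x + U] spans the lift of [x] and the copy of [U] at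
    height 0, whence the extra 1. *)
Lemma rank_homog_affine m k (q : 'I_k -> 'rV[R]_m) (x : 'rV[R]_m)
    (U : {vspace 'rV[R]_m}) :
  (forall y, (lift1 y <= homog q)%MS <-> exists2 u, u \in U & y = x + u) ->
  \rank (homog q) = (\dim U).+1.
Proof.
move=> H; pose B : 'M[R]_(\dim U, m) := \matrix_i (vbasis U)`_i.
pose N := col_mx (lift1 x) (row_mx (0 : 'cV[R]_(\dim U)) B).
have yB (y : 'rV_(\dim U)) : y *m B = \sum_i y 0 i *: (vbasis U)`_i.
  by rewrite mulmx_sum_row; apply: eq_bigr => i _; rewrite rowK.
have UB u : u \in U <-> exists y : 'rV_(\dim U), u = y *m B.
  split=> [/coord_vbasis->|[y ->]].
    by exists (\row_i coord (vbasis U) i u); rewrite yB;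
      apply: eq_bigr => i _; rewrite mxE.
  by rewrite yB memv_suml // => i _; rewrite memvZ // vbasis_mem // mem_nth //
    size_tuple.
have freeN : row_free N.
  rewrite -kermx_eq0; apply/rowV0P => y; rewrite sub_kermx => /eqP.
  rewrite -[y]hsubmxK mul_row_col !mul_mx_row add_row_mx mulmx0 addr0.
  rewrite -[0]row_mx0 => /eq_row_mx[a0].
  have {a0}-> : lsubmx y = 0.
    rewrite -[lsubmx y]mulmx1 (_ : 1%:M = const_mx 1) //.
    by apply/matrixP => i j; rewrite !mxE !ord1.
  rewrite mul0mx add0r yB => y0.
  have /freeP/(_ _ y0) z0 := basis_free (vbasisP U).
  by rewrite (_ : rsubmx y = 0) ?row_mx0 //; apply/rowP => i; rewrite z0 mxE.
have /eqP <- : \rank N == (\dim U).+1 by [].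
apply/eqmx_rank/andP; split; last first.
  rewrite col_mx_sub; apply/andP; split; first by apply/H; exists 0;
    rewrite ?mem0v ?addr0.
  apply/row_subP => i; rewrite row_row_mx.
  have -> : row_mx (row i 0) (row i B) = lift1 (x + row i B) - lift1 x.
    by rewrite opp_row_mx add_row_mx subrr addrAC subrr add0r row0.
  apply: addmx_sub; last rewrite eqmx_opp; apply/H.
    by exists (row i B) => //; apply/UB; exists (delta_mx 0 i); rewrite -rowE.
  by exists 0; rewrite ?mem0v ?addr0.
apply/row_subP => i; rewrite rowK.
have [|u /UB[y ->] ->] := (H (q i)).1.
  by have := row_sub i (homog q); rewrite rowK.
apply/submxP; exists (row_mx 1%:M y).
by rewrite mul_row_col mul1mx mul_mx_row mulmx0 add_row_mx addr0.
Qed.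

Lemma has_dim_hull m k (q : 'I_k -> 'rV[R]_m) d :
  has_dim (hull q [set: 'I_k]%SET) d <-> \rank (homog q) = d.+1.
Proof.
have affE y : affine_hull (hull q [set: 'I_k]%SET) y <-> (lift1 y <= homog
  q)%MS.
  rewrite lift1_sub_homog affine_hull_hullP; split=> -[w] => [[_ ? ?]|[? ?]];
    exists w => //.
  by split=> // i; rewrite finset.in_setT.
split=> [[x [U [<- aff]]]|rq].
  apply: (@rank_homog_affine _ _ _ x) => y; rewrite -affE aff.
  by split=> [[u uU <-]|[u uU ->]]; exists u.
case: k q affE rq => [q _|k q affE rq].
  by rewrite [homog q]flatmx0 mxrank0.
pose X := [tuple q i - q ord0 | i < k.+1].
have XE (i : 'I_k.+1) : X`_i = q i - q ord0 by rewrite -tnth_nth tnth_mktuple.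
have affX y : (lift1 y <= homog q)%MS <-> exists2 u,
  u \in <<X>>%VS & y = q ord0 + u.
  rewrite lift1_sub_homog; split=> [[w [w1 ->]]|[u /coord_span -> ->]].
    exists (\sum_i w i *: (q i - q ord0)).
      apply: memv_suml => i _; rewrite memvZ // memv_span //.
      by rewrite -XE mem_nth // size_tuple.
    under [X in _ = _ + X]eq_bigr do rewrite scalerBr.
    rewrite sumrB -scaler_suml w1 scale1r.
    by rewrite addrC subrK.
  pose a i := coord X i u.
  (* The weight missing to a total of 1 goes to the base point [q ord0], whose difference vector is
     zero. *)
  exists (fun i => a i + (i == ord0)%:R * (1 - \sum_j a j)); split.
    have d1 : \sum_(i < k.+1) (i == ord0)%:R = 1 :> R.
      by rewrite (bigD1 ord0) //= big1 ?addr0 // => i /negPf ->.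
    by rewrite big_split /= -mulr_suml d1 mul1r addrC subrK.
  have d1 (c : R) : \sum_(i < k.+1) ((i == ord0)%:R * c) *: q i = c *: q ord0.
    rewrite (bigD1 ord0) //= mul1r big1 ?addr0 // => i /negPf ->.
    by rewrite mul0r scale0r.
  under [RHS]eq_bigr do rewrite scalerDl.
  rewrite big_split /= d1 scalerBl scale1r.
  under [X in _ + X = _]eq_bigr do rewrite XE scalerBr.
  rewrite sumrB -scaler_suml.
  by rewrite addrCA.
exists (q ord0), <<X>>%VS; split.
  by apply/eqP; rewrite -eqSS -rq (rank_homog_affine affX).
apply/seteqP; split=> y /=.
  by move=> /affE/affX[u uX ->]; exists u.
by move=> [u uX <-]; apply/affE/affX; exists u.
Qed.

Lemma hull_comp m n (p : 'I_n -> 'rV[R]_m) (J : {set 'I_n}) k (f : 'I_k ->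
  'I_n) :
  (forall i, i \in J <-> exists j, i = f j) ->
  hull p J = hull (p \o f) [set: 'I_k]%SET.
Proof.
move=> fJ; apply/seteqP; split; apply: hull_sub (@convex_hull_convex _ _ _) _
  => i iJ.
  have [j ->] := (fJ i).1 iJ.
  by apply: (@mem_hull _ _ _ (p \o f)); rewrite finset.in_setT.
by apply: mem_hull; apply/fJ; exists i.
Qed.

Lemma homog_comp m n (p : 'I_n -> 'rV[R]_m) k (f : 'I_k -> 'I_n) :
  homog (p \o f) = rowsub f (homog p).
Proof. by apply/row_matrixP => i; rewrite rowK row_rowsub rowK. Qed.

(** At most three irredundant points are affinely independent: a nonzero dependency and its negative
    each have two negative coordinates, which takes four points. A larger [J] contains three of them
    and has dimension at least 2. *)
Lemma has_dim_hull_card m n (p : 'I_n -> 'rV[R]_m) (J : {set 'I_n}) d :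
  irredundant p -> (d <= 1)%N -> has_dim (hull p J) d <-> #|J| = d.+1.
Proof.
move=> irp d1.
have smallfree k (f : 'I_k -> 'I_n) : injective f -> (k <= 3)%N ->
    \rank (homog (p \o f)) = k.
  move=> injf k3; apply/eqP; rewrite -/(row_free _) -kermx_eq0;
    apply/rowV0P => y.
  rewrite sub_kermx homog_comp => /eqP y0.
  pose z := y *m rowsub f 1%:M.
  have zf j : z 0 (f j) = y 0 j by apply: mul_rowsub1.
  have zp : z *m homog p = 0 by rewrite -mulmxA -rowsubE.
  have [z0|z0] := eqVneq z 0; first by apply/rowP => j; rewrite -zf z0 !mxE.
  have sub (x : 'rV_n) : (forall i, x 0 i != 0 -> z 0 i != 0) ->
      negset x \subset [set f j | j : 'I_k].
    move=> xz; apply/fintype.subsetP => i; rewrite finset.inE => xi.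
    apply: contraT => /imsetP nf; have := xz i; rewrite lt_eqF // => /(_ isT).
    rewrite /z mul_rowsub1_notin ?eqxx // => j.
    by apply/eqP => fj; apply: nf; exists j.
  have := irredundant_gale irp zp z0.
  have : (1 < #|negset (- z)|)%N.
    by apply: (irredundant_gale irp); rewrite ?mulNmx ?zp ?oppr0 ?oppr_eq0.
  have : (#|negset z :|: negset (- z)| <= 3)%N.
    apply: leq_trans k3; rewrite -[leqRHS]card_ord -(card_imset _ injf).
    apply: subset_leq_card; rewrite finset.subUset; apply/andP; split;
      apply: sub => // i.
    by rewrite mxE oppr_eq0.
  have dis : negset z :&: negset (- z) = finset.set0.
    by apply/setP => i; rewrite !finset.inE [(- z) 0 i]mxE oppr_lt0;
      case: ltgtP.
  have := cardsUI (negset z) (negset (- z)); rewrite dis cards0.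
  by move: #|_ :|: _| #|negset z| #|negset (- z)| => a b c; clear; lia.
have [f injf fJ] := enum_set_card (erefl #|J|).
rewrite (hull_comp p fJ) has_dim_hull.
have [J3|J3] := leqP #|J| 3; first by rewrite smallfree.
have rank3 : (3 <= \rank (homog (p \o f)))%N.
  have J3' : (3 <= #|J|)%N by apply: ltnW.
  rewrite -(smallfree _ (f \o widen_ord J3')) //; last first.
    by move=> i j /injf /(congr1 val) /= /val_inj.
  rewrite -[p \o (f \o _)]/((p \o f) \o _) [in leqLHS]homog_comp.
  exact: mxrankS (rowsub_sub _ _).
have d3 : (d.+1 < 3)%N by [].
split=> [rd|cd]; first by rewrite rd leqNgt d3 in rank3.
by have := leq_trans (leq_trans d3 (ltnW J3)) (eq_leq cd); rewrite ltnn.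
Qed.

End Dimension.

(** * Counting vertices and edges *)

Section FaceNumbers.
Context {R : realType}.

Lemma card_fset_set_image (I : finType) (T : choiceType) (S : {set I}) (f : I
  -> T)
    (A : set T) :
  {in S &, injective f} -> (forall t, A t <-> exists2 i, i \in S & t = f i) ->
  #|` fset_set A|%fset = #|S|.
Proof.
move=> injf Af; pose s := [seq f i | i <- enum S].
have -> : A = [set` [fset x in s]%fset]%classic.
  apply/seteqP; split=> t /=; rewrite finmap.inE /=.
    by move=> /Af[i iS ->]; apply: map_f; rewrite mem_enum.
  by move=> /mapP[i]; rewrite mem_enum => iS ->; apply/Af; exists i.
rewrite set_fsetK card_fseq undup_id ?size_map -?cardE //.
rewrite map_inj_in_uniq ?enum_uniq // => i j; rewrite !mem_enum; exact: injf.
Qed.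

Lemma fnum_hull m n (p : 'I_n -> 'rV[R]_m) (S : {set {set 'I_n}}) d :
    irredundant p -> (d <= 1)%N ->
    (forall J, J \in S <-> #|J| = d.+1 /\ slack_face p J) ->
  fnum (hull p [set: 'I_n]%SET) d = #|S|.
Proof.
move=> irp d1 SP; apply: (@card_fset_set_image _ _ _ (hull p)).
  by move=> J J' /SP[_ fJ] /SP[_ fJ']; apply: slack_face_hull_inj.
move=> F; split=> [[/facesP[J [fJ FJ]] dF]|[J /SP[cJ fJ] ->]].
  by exists J => //; apply/SP; split=> //; apply/(has_dim_hull_card _ irp d1);
    rewrite -FJ.
by split; [apply/facesP; exists J | apply/has_dim_hull_card].
Qed.

Section Irredundant.
Context {m n k : nat} {p : 'I_n -> 'rV[R]_m} {K : 'M[R]_(k, n)}.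
Hypothesis irp : irredundant p.
Hypothesis kerK : forall x : 'rV[R]_n, x *m homog p = 0 <-> exists y,
  x = y *m K.

Lemma slack_face_set1 i : slack_face p [set i]%SET.
Proof.
apply: dep_slack_face => x xp xi.
have -> : x = 0; last by move=> j _; rewrite mxE.
apply/eqP; apply: contraT => /(irredundant_gale irp xp); rewrite ltnNge.
move=> /negP[]; rewrite -(cards1 i); apply/subset_leq_card/fintype.subsetP => j.
by apply: contraTT => ji; rewrite finset.inE -leNgt xi.
Qed.

(** A dependency realizing a coedge [e] would vanish off [e] if [e] were a face, and its coordinates
    could not sum to 0. Conversely, a dependency that obstructs [e] is negative only on [e], hence
    on all of [e]. *)
Lemma slack_face_set2 (e : {set 'I_n}) :
  #|e| = 2%N -> slack_face p e <-> e \notin coedges K.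
Proof.
move=> e2; split=> [fe|eK].
  apply/negP => /coedgesP[_ [y ye]]; pose x := y *m K.
  have xp : x *m homog p = 0 by apply/kerK; exists y.
  have xe i : i \notin e -> 0 <= x 0 i by rewrite -ye finset.inE -leNgt.
  have x0 := slack_face_dep fe xp xe.
  have [/eqP x1 _] := (mul_homog_eq0 p x).1 xp.
  have : e = finset.set0.
    apply/setP => i; rewrite finset.in_set0 -ye finset.inE -/x;
      apply/negP => xi.
    move: x1; rewrite -oppr_eq0 -sumrN psumr_eq0 => [/allP/(_ i (mem_index_enum
      _))|j _].
      by rewrite oppr_eq0 lt_eqF.
    have [je|/x0->] := boolP (j \in e); last by rewrite oppr0.
    by rewrite oppr_ge0 ltW //; move: je; rewrite -ye finset.inE.
  by move=> e0; rewrite e0 cards0 in e2.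
apply: dep_slack_face => x xp xe i ie; apply/eqP; apply: contraNT eK => xi.
have x0 : x != 0 by apply: contraNneq xi => ->; rewrite mxE.
have [y xy] := (kerK x).1 xp.
apply/coedgesP; split=> //; exists y; rewrite -xy; apply/eqP.
rewrite eqEcard e2 (irredundant_gale irp xp x0) andbT.
by apply/fintype.subsetP => j; apply: contraTT => je;
  rewrite finset.inE -leNgt xe.
Qed.

Lemma fnum0_hull : fnum (hull p [set: 'I_n]%SET) 0 = n.
Proof.
rewrite (@fnum_hull _ _ _ [set [set i] | i : 'I_n]%SET) //.
  by rewrite card_imset ?card_ord //; apply: set1_inj.
move=> J; split=> [/imsetP[i _ ->]|[/eqP/cards1P[i ->] _]]; last exact: imset_f.
by rewrite cards1; split=> //; apply: slack_face_set1.
Qed.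

Lemma fnum1_hull : (fnum (hull p [set: 'I_n]%SET) 1 + #|coedges K| = 'C(n,
  2))%N.
Proof.
rewrite (@fnum_hull _ _ _ ([set e : {set 'I_n} | #|e| == 2%N] :\: coedges
  K)%SET) //.
  have sub : coedges K \subset [set e : {set 'I_n} | #|e| == 2%N]%SET.
    by apply/fintype.subsetP => e /coedgesP[e2 _]; rewrite finset.inE e2.
  rewrite cardsD (finset.setIidPr sub) subnK ?subset_leq_card //.
  by rewrite card_draws card_ord.
move=> J; split=> [/finset.setDP[]|[J2 fJ]].
  rewrite finset.inE => /eqP J2 JK; split; first exact: J2.
  by apply/(slack_face_set2 J2).
apply/finset.setDP; split; first by rewrite finset.inE J2.
by apply/(slack_face_set2 J2).
Qed.

End Irredundant.
End FaceNumbers.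

(** * The triplex *)

Section Pyramids.
Context {R : realType}.

Lemma hullU1 m n (p : 'I_n -> 'rV[R]_m) (J : {set 'I_n}) z :
  hull p (z |: J)%SET = convex_hull (hull p J `|` [set p z])%classic.
Proof.
apply/seteqP; split.
  apply: hull_sub (@convex_hull_convex _ _ _) _ => i.
  rewrite finset.in_setU1 => /orP[/eqP->|iJ] C [_]; apply; first by right.
  by left; apply: mem_hull.
apply: smallest_sub; first exact: convex_hull_convex.
move=> y [|->]; last by apply: mem_hull; rewrite setU11.
by move: y; apply: hull_sub (@convex_hull_convex _ _ _) _ => i iJ;
  apply: mem_hull; rewrite setU1r.
Qed.

(** A point at which every dependency vanishes is not an affine combination of the others, so it can
    serve as an apex. *)
Lemma iterated_pyramid_hull m n (p : 'I_n -> 'rV[R]_m) (B L : {set 'I_n}) :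
    (forall z, z \in L -> forall x : 'rV[R]_n, x *m homog p = 0 -> x 0 z = 0) ->
    [disjoint B & L] ->
  iterated_pyramid #|L| (hull p B) (hull p (B :|: L)%SET).
Proof.
move: {2}#|L| (erefl #|L|) => l; elim: l L => [|l IHl] L lL H dis.
  by rewrite lL /=; move/eqP: lL; rewrite cards_eq0 => /eqP->;
    rewrite finset.setU0.
rewrite lL /=.
have /card_gt0P[z zL] : (0 < #|L|)%N by rewrite lL.
have lLz : #|L :\ z| = l by move: lL; rewrite (cardsD1 z) zL add1n => -[].
exists (hull p (B :|: (L :\ z))%SET), (p z); split.
- rewrite -lLz; apply: IHl => // [y|].
    by rewrite finset.in_setD1 => /andP[_ /H].
  apply: (disjointWr _ dis); exact: subD1set.
- move=> /affine_hull_hullP[w [wJ w1 pz]].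
  pose x : 'rV[R]_n := (\row_i w i) - delta_mx 0 z.
  have xE i : x 0 i = w i - (i == z)%:R by rewrite !mxE eqxx.
  have zB : z \notin (B :|: (L :\ z))%SET.
    rewrite !finset.inE eqxx orbF; move: dis;
      rewrite disjoint_sym => /disjointFr.
    by move=> /(_ z zL) ->.
  have : x 0 z = 0.
    apply: (H z zL); apply/mul_homog_eq0; split.
      under eq_bigr do rewrite xE; rewrite sumrB w1 (bigD1 z) //= eqxx big1
        ?addr0 ?subrr //.
      by move=> i /negPf->.
    under eq_bigr do rewrite xE scalerBl; rewrite sumrB -pz (bigD1 z) //= eqxx
      scale1r.
    by rewrite big1 ?addr0 ?subrr // => i /negPf->; rewrite scale0r.
  by move=> /eqP; rewrite xE (wJ z zB) eqxx sub0r oppr_eq0 oner_eq0.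
rewrite -hullU1; congr (hull p _); apply/setP => i; rewrite !finset.inE.
by have [->|] := eqVneq i z; rewrite ?zL ?orbT.
Qed.

End Pyramids.

(** * Combinatorial equivalence from dependencies *)

Section Equivalence.
Context {R : realType}.

Lemma combinatorially_equivalent_hull m m' n (p : 'I_n -> 'rV[R]_m)
    (q : 'I_n -> 'rV[R]_m') :
  (forall J, slack_face p J <-> slack_face q J) ->
  combinatorially_equivalent (hull p [set: 'I_n]%SET) (hull q [set: 'I_n]%SET).
Proof.
move=> pq; pose f (F : set 'rV[R]_m) := hull q [set i | `[< F (p i) >]]%SET.
have fE J : slack_face p J -> f (hull p J) = hull q J.
  move=> fJ; congr (hull q _); apply/setP => i; rewrite finset.inE.
  by apply/asboolP/idP => [|iJ]; [apply: slack_face_mem | apply: mem_hull].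
exists f; split; last first.
  move=> F G /facesP[J [fJ ->]] /facesP[J' [fJ' ->]]; rewrite !fE //.
  by rewrite !slack_face_hull_sub //; apply/pq.
split=> [F /facesP[J [fJ ->]]|F G|G /facesP[J [fJ ->]]].
- by rewrite fE //; apply/facesP; exists J; split=> //; apply/pq.
- rewrite !in_setE => /facesP[J [fJ ->]] /facesP[J' [fJ' ->]];
  rewrite !fE // => JJ.
  by rewrite (slack_face_hull_inj _ _ JJ) //; apply/pq.
- have fpJ : slack_face p J by apply/pq.
  by exists (hull p J); [apply/facesP; exists J | rewrite fE].
Qed.

(** The Fredholm alternative: a vector orthogonal to the left kernel lies in the column space. *)
Lemma solve_of_kernel n k (M : 'M[R]_(n, k)) (s : 'cV[R]_n) :
  (forall x : 'rV_n, x *m M = 0 -> x *m s = 0) -> exists c, s = M *m c.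
Proof.
move=> H; have : (s^T <= M^T)%MS.
  rewrite submxE -[X in X == 0]trmxK -trmx0 (inj_eq (@trmx_inj _ _ _)) trmx_mul
    trmxK.
  apply/eqP/row_matrixP => i; rewrite row_mul row0; apply: H.
  by rewrite -row_mul -[M in _ *m M]trmxK -trmx_mul mulmx_coker trmx0 row0.
by move=> /submxP[c sc]; exists c^T; apply: trmx_inj; rewrite trmx_mul trmxK.
Qed.

(* The slack vectors of [p] are the vectors orthogonal to its affine
   dependencies, so rescaling the dependencies rescales them inversely. *)
Lemma slack_face_rescale m m' n (p : 'I_n -> 'rV[R]_m) (q : 'I_n -> 'rV[R]_m')
    (c : 'I_n -> R) (J : {set 'I_n}) :
    (forall i, 0 < c i) ->
    (forall x : 'rV[R]_n, x *m homog q = 0 ->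
      (\row_i (c i * x 0 i)) *m homog p = 0) ->
  slack_face p J -> slack_face q J.
Proof.
move=> c0 qp [a aJ]; pose s : 'cV[R]_n := \col_i (c i * (homog p *m a) i 0).
have [|b sb] := @solve_of_kernel _ _ (homog q) s.
  move=> x /qp xp; apply/rowP => j; rewrite ord1.
  have := congr1 (mulmx^~ a) xp; rewrite mul0mx -mulmxA => /rowP/(_ 0).
  rewrite [in X in X -> _]mxE => H; rewrite mxE -[RHS]H.
  by apply: eq_bigr => i _; rewrite !mxE; ring.
exists b => i; rewrite -sb mxE; have [a0 aE] := aJ i.
by rewrite pmulr_rge0 // mulf_eq0 gt_eqF.
Qed.

End Equivalence.

(** * A model of the prism over a tetrahedron *)

Section PrismModel.
Context {R : realType}.

Notation I := ('I_4 * bool)%type.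
Notation N := #|{: 'I_4 * bool}|.
Notation e := (@enum_val I predT).

Lemma sum_enum_prod (V : nmodType) (F : I -> V) :
  \sum_(i < N) F (e i) = \sum_j (F (j, true) + F (j, false)).
Proof.
transitivity (\sum_a F a).
  by rewrite [RHS](reindex _ (onW_bij _ (enum_val_bij I))).
rewrite (eq_bigr (fun a => F (a.1, a.2))) => [|[]//].
rewrite -(pair_bigA _ (fun j b => F (j, b))) /=.
by apply: eq_bigr => j _; rewrite big_bool.
Qed.

Lemma sum_row_mx m1 m2 n (A : 'I_n -> 'rV[R]_m1) (B : 'I_n -> 'rV[R]_m2) :
  \sum_i row_mx (A i) (B i) = row_mx (\sum_i A i) (\sum_i B i).
Proof.
rewrite -[LHS]hsubmxK !linear_sum /=; congr row_mx; apply: eq_bigr => i _.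
  by rewrite row_mxKl.
by rewrite row_mxKr.
Qed.

Definition corner (i : 'I_4) : 'rV[R]_4 := delta_mx 0 i.
Definition endpoint (j : 'I_2) : 'rV[R]_1 := const_mx j%:R.
Definition prism_point (a : I) : 'rV[R]_(4 + 1) :=
  row_mx (corner a.1) (endpoint (if a.2 then 1 else 0)).

Lemma simplex_corner : simplex 3 (hull corner [set: 'I_4]%SET).
Proof.
exists corner; last by rewrite hullT.
move=> w _ wc i; move/rowP/(_ i): wc; rewrite summxE (bigD1 i) //= !mxE !eqxx.
rewrite mulr1 big1 ?addr0 // => j ji.
by rewrite !mxE eq_sym (negPf ji) andbF mulr0.
Qed.

Lemma simplex_endpoint : simplex 1 (hull endpoint [set: 'I_2]%SET).
Proof.
exists endpoint; last by rewrite hullT.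
move=> w; rewrite big_ord_recl big_ord1 => w1 wc.
have w11 : w (lift ord0 ord0) = 0.
  move/rowP/(_ 0): wc; rewrite big_ord_recl big_ord1 !mxE.
  by rewrite mulr0 add0r mulr1.
have w00 : w ord0 = 0 by move: w1; rewrite w11 addr0.
move=> i; case: (unliftP ord0 i) => [j|] -> //.
by rewrite ord1 w11.
Qed.

Lemma product_hull :
  cartesian_product (hull corner [set: 'I_4]%SET) (hull endpoint [set:
    'I_2]%SET) =
  hull (fun i : 'I_N => prism_point (e i)) [set: 'I_N]%SET.
Proof.
apply/seteqP; split=> [_ [x /hullP[a [a0 _ a1 ->]] [y /hullP[b [b0 _ b1 ->]]
  <-]]|].
  have {}b1 : b ord0 + b (lift ord0 ord0) = 1 by rewrite -b1 big_ord_recl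
    big_ord1.
  pose be (c : bool) := b (if c then lift ord0 ord0 else ord0).
  apply/hullP; exists (fun i => a (e i).1 * be (e i).2); split=> [i|i||].
  - by rewrite mulr_ge0 // /be.
  - by rewrite finset.in_setT.
  - rewrite (sum_enum_prod (fun u => a u.1 * be u.2)) /= -[RHS]a1.
    by apply: eq_bigr => j _; rewrite -mulrDr /be addrC b1 mulr1.
  rewrite (sum_enum_prod (fun u => (a u.1 * be u.2) *: prism_point u)) /=.
  have -> : \sum_j ((a j * be true) *: prism_point (j, true) +
      (a j * be false) *: prism_point (j, false)) =
      \sum_j row_mx (a j *: corner j) (a j *: (b ord0 *: endpoint ord0 +
        b (lift ord0 ord0) *: endpoint (lift ord0 ord0))).
    apply: eq_bigr => j _; rewrite /prism_point !scale_row_mx add_row_mx /be.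
    congr row_mx.
      by rewrite -scalerDl -mulrDr addrC b1 mulr1.
    rewrite scalerDr !scalerA addrC; congr (_ *: _ + _ *: endpoint _).
    exact: val_inj.
  rewrite sum_row_mx -scaler_suml a1 scale1r; congr row_mx.
  by rewrite big_ord_recl big_ord1.
apply: hull_sub => [|i _].
  move=> x y t; rewrite !in_setE => -[x1 Sx1 [x2 Tx2 <-]] [y1 Sy1 [y2 Ty2 <-]].
  have Sxy := @convex_hull_convex _ _ _ x1 y1 t (mem_set Sx1) (mem_set Sy1).
  have Txy := @convex_hull_convex _ _ _ x2 y2 t (mem_set Tx2) (mem_set Ty2).
  eexists; first exact: set_mem Sxy.
  eexists; first exact: set_mem Txy.
  by rewrite /conv /= !scale_row_mx add_row_mx.
exists (corner (e i).1); first by apply: mem_hull; rewrite finset.in_setT.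
by exists (endpoint (if (e i).2 then 1 else 0)); first by apply: mem_hull;
  rewrite finset.in_setT.
Qed.

(** The coordinates along [corner] force opposite values at the two ends of each edge between the
    bases; the coordinate along [endpoint] makes the values on one base sum to 0. *)
Lemma prism_dep (x : 'rV[R]_N) :
  x *m homog (fun i : 'I_N => prism_point (e i)) = 0 <->
  exists Y : 'I_4 -> R, \sum_j Y j = 0 /\
    forall i, x 0 i = (-1) ^+ (e i).2 * Y (e i).1.
Proof.
pose x' (a : I) := x 0 (enum_rank a).
have xx' i : x 0 i = x' (e i) by rewrite /x' enum_valK.
rewrite mul_homog_eq0.
rewrite (eq_bigr (fun i => x' (e i))) ?sum_enum_prod //.
rewrite (eq_bigr (fun i => x' (e i) *: prism_point (e i))) => [|i _];
  last by rewrite xx'.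
rewrite (sum_enum_prod (fun a => x' a *: prism_point a)).
rewrite (eq_bigr (fun j => row_mx ((x' (j, true) + x' (j, false)) *: corner j)
    (x' (j, true) *: endpoint 1))) => [|j _]; last first.
  rewrite /prism_point !scale_row_mx add_row_mx -scalerDl.
  by congr row_mx; apply/rowP => i; rewrite !mxE mulr0 addr0.
rewrite sum_row_mx -scaler_suml.
split=> [[_]|[Y [Y0 xY]]].
  move=> xr; have /eq_row_mx[/rowP xc /rowP/(_ 0)] :=
    etrans xr (esym (row_mx0 _ _ _ _)).
  rewrite !mxE mulr1 => xt.
  have xtf j : x' (j, true) = - x' (j, false).
    have := xc j; rewrite summxE (bigD1 j) //= big1 ?addr0 => [|k kj].
      by rewrite !mxE !eqxx mulr1 => /eqP; rewrite addr_eq0 => /eqP.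
    by rewrite !mxE eq_sym (negPf kj) andbF mulr0.
  exists (fun j => x' (j, false)); split.
    have xt' : \sum_j - x' (j, false) = 0.
      by rewrite -[RHS]xt; apply: eq_bigr => j _; rewrite xtf.
    by apply/eqP; rewrite -oppr_eq0 -sumrN xt'.
  move=> i; rewrite xx'; case: (e i) => j [] /=; last by rewrite expr0 mul1r.
  by rewrite expr1 mulN1r xtf.
have x'E j c : x' (j, c) = (-1) ^+ c * Y j by rewrite /x' xY enum_rankK.
have xtf j : x' (j, true) + x' (j, false) = 0.
  by rewrite !x'E expr1 expr0 mulN1r mul1r addNr.
split; first by rewrite big1.
rewrite big1 => [|j _]; last by rewrite xtf scale0r.
rewrite (eq_bigr (fun j => - Y j)) => [|j _]; last by rewrite x'E expr1 mulN1r.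
by rewrite sumrN Y0 oppr0 scale0r row_mx0.
Qed.

End PrismModel.

Section Triplex.
Context {R : realType}.

(** The eight points [l a] span a polytope whose dependencies are those of the model prism up to the
    factors [c], and all remaining points are apexes. *)
Lemma prismatic_triplex m n (p : 'I_n -> 'rV[R]_m) :
  prismatic (fun x => x *m homog p = 0) -> triplex 4 (n - 8) (hull p [set:
    'I_n]%SET).
Proof.
move=> [l [c [linj c0 lP]]].
pose B := [set l a | a : 'I_4 * bool]%SET.
have cB : #|B| = 8%N by rewrite card_imset // card_prod card_ord card_bool.
have lB z : z \notin B -> forall a, l a != z.
  by move=> zB a; apply: contraNneq zB => <-; apply: imset_f.
pose N := #|{: 'I_4 * bool}|; pose e := @enum_val ('I_4 * bool)%type predT.
pose f (i : 'I_N) := l (e i).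
have finj : injective f by move=> i j /linj /enum_val_inj.
(* The polytope itself is the iterated pyramid, so the outer equivalence is the identity. *)
exists m, (hull p B), (hull p [set: 'I_n]%SET); split; last first.
- exists id; split=> //; split=> [F //|F G _ _ //|F PF]; by exists F.
- have -> : (n - 8)%N = #|~: B| by rewrite cardsCs finset.setCK cB card_ord.
  rewrite -(finset.setUCr B); apply: iterated_pyramid_hull.
    move=> z; rewrite finset.in_setC => zB x /lP[Y [_ _]]; apply; exact: lB.
  by rewrite -setI_eq0 finset.setICr.
have BE : hull p B = hull (p \o f) [set: 'I_N]%SET.
  apply: hull_comp => i; split=> [/imsetP[a _ ->]|[j ->]]; last exact: imset_f.
  by exists (enum_rank a); rewrite /f /e enum_rankK.
have depE (x : 'rV[R]_N) : x *m homog (p \o f) = 0 <->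
    exists Y : 'I_4 -> R, \sum_j Y j = 0 /\ forall i,
      x 0 i = c (e i) * ((-1) ^+ (e i).2 * Y (e i).1).
  pose z := x *m rowsub f 1%:M.
  have zf j : z 0 (f j) = x 0 j by apply: mul_rowsub1.
  have -> : x *m homog (p \o f) = z *m homog p.
    by rewrite homog_comp -mulmxA -rowsubE.
  rewrite lP; split=> -[Y] => [[Y0 zl _]|[Y0 xY]]; exists Y.
    by split=> // i; rewrite -zl zf.
  split=> // [a|y ly].
    have -> : l a = f (enum_rank a) by rewrite /f /e enum_rankK.
    by rewrite zf xY /e enum_rankK.
  by apply: mul_rowsub1_notin => j; apply: ly.
split; first by exists (p @` [set` B])%classic => //; apply: finite_image.
exists 4%N, 1%N, (hull corner [set: 'I_4]%SET), (hull endpoint [set: 'I_2]%SET).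
split; [exact: simplex_corner|exact: simplex_endpoint|].
rewrite product_hull BE; apply: combinatorially_equivalent_hull => J; split.
  apply: (@slack_face_rescale _ _ _ _ _ _ (fun i => c (e i))) => // x
    /prism_dep[Y [Y0 xY]].
  by apply/depE; exists Y; split=> // i; rewrite mxE xY.
apply: (@slack_face_rescale _ _ _ _ _ _ (fun i => (c (e i))^-1)) => [i|x
  /depE[Y [Y0 xY]]].
  by rewrite invr_gt0.
apply/prism_dep; exists Y; split=> // i.
by rewrite mxE xY mulKf // gt_eqF.
Qed.

End Triplex.

(** * Edge numbers for [d + 4] vertices *)

Lemma double_bin2 n : (2 * 'C(n.+1, 2) = n.+1 * n)%N.
Proof. by elim: n => // n IHn; rewrite binS bin1 mulnDr IHn; lia. Qed.

(** Here [k] is the number of coedges, the non-edges of [P]. The dependencies of the vertices form a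
    space of dimension [(d + 4) - (d + 1) = 3]. *)
Lemma polytope_d4_edges (R : realType) (d n : nat) (P : set 'rV[R]_n) :
    polytope P -> has_dim P d -> fnum P 0 = (d + 4)%N ->
  exists k, (fnum P 1 + k = 'C(d + 4, 2))%N /\
    ((k <= 10)%N \/ (12 <= k)%N /\ triplex 4 (d - 4) P).
Proof.
move=> /polytope_irredundant[v [p [irp ->]]] dimP.
rewrite (fnum0_hull irp) => vd.
have rk := (has_dim_hull p d).1 dimP.
have rker : \rank (kermx (homog p)) = 3%N by rewrite mxrank_ker rk vd; lia.
(* Quantifying over [K] allows the rank in its type to be replaced by 3. *)
have : exists2 K : 'M[R]_(\rank (kermx (homog p)), v),
  row_free K & (K :=: kermx (homog p))%MS.
  by exists (row_base (kermx (homog p))); [exact: row_base_free|exact: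
    eq_row_base].
rewrite rker => -[K freeK eqK].
have kerK (x : 'rV_v) : x *m homog p = 0 <-> exists y, x = y *m K.
  split=> [/eqP|[y ->]]; first by rewrite -sub_kermx -eqK => /submxP.
  by apply/eqP; rewrite -sub_kermx -eqK submxMl.
have gK : gale K.
  move=> x x0; apply: (irredundant_gale irp); first by apply/kerK; exists x.
  by rewrite -(mul0mx _ K) (inj_eq (row_free_inj freeK)).
exists #|coedges K|; split; first by rewrite (fnum1_hull irp kerK) vd.
have [|prK] := coedges_le10_or_prismatic gK; [by left|right].
split; first exact: prismatic_coedges.
have -> : (d - 4 = v - 8)%N by rewrite vd; lia.
have [l [c [linj c0 lP]]] := prK; apply: prismatic_triplex; exists l, c;
  split=> // x.
by rewrite kerK lP.
Qed.

Theorem theorem19 (R : realType) (d : nat) (d_ge4 : (4 <= d)%N) :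
  (~ exists (n : nat) (P : set 'rV[R]_n),
       [/\ polytope P, has_dim P d, fnum P 0 = (d + 4)%N
         & fnum P 1 = (phi (d + 4) d + 1)%N])
  /\
  (forall (n : nat) (P : set 'rV[R]_n),
     polytope P -> has_dim P d -> fnum P 0 = (d + 4)%N ->
     triplex 4 (d - 4) P \/ 3 * d%:Z - 8 <= excess_degree P d).
Proof.
have [c dE] : exists c, d = c.+4 by exists (d - 4)%N; lia.
have bin8 := double_bin2 c.+4.+3.
split=> [[n [P [PP dP P0 P1]]]|n P PP dP P0].
  have [k [Pk kP]] := polytope_d4_edges PP dP P0.
  (* The number [phi (d + 4) d] is the number of pairs of vertices minus 12, so one more edge leaves
     11 non-edges. *)
  have k11 : k = 11%N.
    move: Pk; rewrite P1 /phi.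
    have -> : ((2 * d).+1 - (d + 4) = c.+1)%N by lia.
    have := double_bin2 c; have := double_bin2 c.+3; have := double_bin2 c.+4.
    have -> : (d + 4 = c.+4.+4)%N by lia.
    rewrite dE; move: bin8.
    move: 'C(_, 2) 'C(_, 2) 'C(_, 2) 'C(_, 2) => b1 b2 b3 b4.
    nia.
  by case: kP => [|[]]; rewrite k11.
have [k [Pk [k10|[_ tP]]]] := polytope_d4_edges PP dP P0; [right|by left].
(* The excess degree equals [3 (d + 4) - 2 k], which is at least [3 d - 8] for [k <= 10]. *)
rewrite /excess_degree P0; move: Pk bin8.
have -> : (d + 4 = c.+4.+4)%N by lia.
move: (fnum P 1) 'C(_, 2) => f1 b Pk; rewrite dE.
nia.
Qed.
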